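(* Assume (A1)–(A4) and let $q=\frac{1}{p-1}$. Then there exist constants $C_1,C_2>0$, depending only on $p$ and $\varepsilon_0$, such that for all $(x,t)\in\Omega$: $C_1(\phi+\psi)^p(x,t)\le\partial_t\phi(x,t)\le C_2(\phi+\psi)^p(x,t)$; $C_1(T(x)-t)^{-q-1}\le\partial_t\phi(x,t)\le C_2(T(x)-t)^{-q-1}$; $C_1(\phi+\psi)^p(x,t)\le\partial_t\psi(x,t)\le C_2(\phi+\psi)^p(x,t)$; $C_1(T(x)-t)^{-q-1}\le\partial_t\psi(x,t)\le C_2(T(x)-t)^{-q-1}$; $C_1(T(x)-t)^{-q}\le(\phi+\psi)(x,t)\le C_2(T(x)-t)^{-q}$.
   Context: Let $p>1$ and $\mu>0$ with $p<1+2/\mu$, and let $R^*,T^*>0$. Write $B_R=\{x\in\mathbb{R}:|x|<R\}$ and $D_\pm=\partial_t\pm\partial_x$. Consider the system $D_-\phi=2^{-p}|\phi+\psi|^p-\frac{\mu}{1+t}\frac{\phi+\psi}{2}$, $D_+\psi=2^{-p}|\phi+\psi|^p-\frac{\mu}{1+t}\frac{\phi+\psi}{2}$, $\phi(x,0)=f(x)$, $\psi(x,0)=g(x)$. Fix $\gamma_1,\gamma_2>0$ with $\gamma_1+\gamma_2>\max\big(1,(\mu p 2^p)^{1/(p-1)}\big)$ and let $T_1=\frac{1}{(p-1)\mu}\ln\Big(\frac{2^{1-p}/\mu}{2^{1-p}/\mu-(\gamma_1+\gamma_2)^{1-p}}\Big)$. Assumptions: (A1) $T_1<T^*$. (A2)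 $f\ge\gamma_1$, $g\ge\gamma_2$ on $B_{R^*+T^*}$. (A3) $f,g\in\mathcal{C}^4(\overline{B_{R^*+T^*}})$. (A4) There is $\varepsilon_0>0$ with $2^{-p}(\gamma_1+\gamma_2)^p-\frac{\mu}{2}(\gamma_1+\gamma_2)\ge(2+\varepsilon_0)\max_{x\in B_{R^*+T^*}}(|f'(x)|+|g'(x)|)$. Let $K_{R^*,T^*}=\{(x,t):t>0,\ |x-x_0|<T^*-t\ \text{for some } x_0\in B_{R^*}\}$. Define iterates $\phi_0\equiv\gamma_1$, $\psi_0\equiv\gamma_2$ and, with $\mathcal{N}_n(x,s)=2^{-p}|\phi_n+\psi_n|^p(x,s)-\frac{\mu}{1+s}\frac{(\phi_n+\psi_n)(x,s)}{2}$, $\phi_{n+1}(x,t)=f(x+t)+\int_0^t\mathcal{N}_n(x+t-s,s)\,ds$, $\psi_{n+1}(x,t)=g(x-t)+\int_0^t\mathcal{N}_n(x-t+s,s)\,ds$. Set $\phi=\sup_n\phi_n$, $\psi=\sup_n\psi_n$ on $K_{R^*,T^*}$, $T(x)=\sup\{t\in(0,T^* ):(\phi+\psi)(x,t)<\infty\}$ for $x\in B_{R^*}$, and $\Omega=\{(x,t):x\in B_{R^*},\ 0<t<T(x)\}$; $(\phi,\psi)$ is the solution of the system on $\Omega$. *)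

(* Defs.v *)
From Stdlib Require Import Reals.
From Coquelicot Require Import Coquelicot.
Open Scope R_scope.

(* |y|^p, with the convention 0^p = 0 (p > 0); Stdlib's Rpower 0 p is 1. *)
Definition powabs (y a : R) : R :=
  if Rlt_dec 0 (Rabs y) then Rpower (Rabs y) a else 0.

Definition Nfun (p mu : R) (ph ps : R -> R -> R) (x s : R) : R :=
  Rpower 2 (- p) * powabs (ph x s + ps x s) p
  - mu / (1 + s) * ((ph x s + ps x s) / 2).

Fixpoint iterates (p mu g1 g2 : R) (f g : R -> R) (n : nat)
  : (R -> R -> R) * (R -> R -> R) :=
  match n with
  | O => (fun _ _ => g1, fun _ _ => g2)
  | S m =>
      let '(ph, ps) := iterates p mu g1 g2 f g m in
      (fun x t => f (x + t) + RInt (fun s => Nfun p mu ph ps (x + t - s) s) 0 t,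
       fun x t => g (x - t) + RInt (fun s => Nfun p mu ph ps (x - t + s) s) 0 t)
  end.

Definition Phi p mu g1 g2 f g (x t : R) : Rbar :=
  Sup_seq (fun n => Finite (fst (iterates p mu g1 g2 f g n) x t)).
Definition Psi p mu g1 g2 f g (x t : R) : Rbar :=
  Sup_seq (fun n => Finite (snd (iterates p mu g1 g2 f g n) x t)).

Definition Tblow p mu g1 g2 f g (Ts x : R) : Rbar :=
  Lub_Rbar (fun t => 0 < t < Ts /\
    is_finite (Rbar_plus (Phi p mu g1 g2 f g x t) (Psi p mu g1 g2 f g x t))).

Definition in_Omega p mu g1 g2 f g (Rs Ts x t : R) : Prop :=
  Rabs x < Rs /\ 0 < t /\ Rbar_lt (Finite t) (Tblow p mu g1 g2 f g Ts x).

Definition cont_on_closed (h : R -> R) (a b : R) : Prop :=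
  forall y, a <= y <= b -> forall eps, 0 < eps -> exists delta, 0 < delta /\
    forall z, a <= z <= b -> Rabs (z - y) < delta -> Rabs (h z - h y) < eps.

Definition C4_closed (h : R -> R) (a b : R) : Prop :=
  cont_on_closed h a b /\
  forall k : nat, (k <= 4)%nat ->
    (forall x, a < x < b -> ex_derive_n h k x) /\
    exists F : R -> R, cont_on_closed F a b /\
      forall x, a < x < b -> F x = Derive_n h k x.

(* Main.v *)
(** Let [F(u, s) = 2^(-p) u^p - mu u / (2 (1 + s))], which increases in [u >= g1 + g2] and in [s],
    and let [lam = 1 + eps0 > 1]. By (A4) every iterate is nondecreasing along the directions
    [(h, k)] with [|h| <= lam k], a property that needs no derivatives and passes to the suprema
    [phi], [psi]. Compared with the characteristics, along which [phi] and [psi] grow at the rate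
    [F], it gives [lam / (1 + lam) F <= d_t phi, d_t psi <= lam / (lam - 1) F], and [F] is
    comparable to [(phi + psi)^p]. Differentiability in [t] follows from a contraction estimate
    for the time difference quotients in the integral equation.

    A spatially constant solution of an ODE that blows up at [T_1 < T*] is a subsolution, so
    [T(x) <= T_1 < T*]. If [phi + psi] stayed bounded on the segment below [(x, T(x))], monotonicity
    in a cone strictly wider than the light cone would bound the iterates beyond [T(x)]; hence
    [phi + psi] tends to infinity there, and integrating [d_t (phi + psi) ~ (phi + psi)^p] up to
    [T(x)] gives the rates. *)
Require Import Defs.
From Stdlib Require Import Reals Lra Lia Psatz.
From Coquelicot Require Import Coquelicot.
Open Scope R_scope.

(** * Integrals and difference quotients *)

(** The obstacle is regularity: a supremum of functions comes with no continuity, let alone a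
    derivative, so bounds on derivatives of the iterates would still have to be carried to the
    limit. An inequality between values avoids this, and [lam > 1] turns it into Lipschitz bounds as
    well: every point near [(x, t)] precedes some point reached from [(x, t)] along a
    characteristic, where the growth is an integral of [F]. The factor [2 + eps0 = 1 + lam] of (A4)
    is what propagates the monotonicity: the feet of the two characteristics compared are at most
    [(1 + lam) k] apart, and the variation of a datum over that distance has to be absorbed by the
    growth [k F(g1 + g2, 0)]. All estimates are local to backward light cones: a bound at the apex
    bounds every iterate in the whole cone. Above the threshold on [g1 + g2] the damping takes at
    most half of [2^(-p) u^p], so that [mu], the radii and the data drop out of the constants. *)

Definition clamp (a b x : R) : R := Rmax a (Rmin b x).

Lemma clamp_in a b x : a <= b -> a <= clamp a b x <= b.
Proof. intros; unfold clamp, Rmax, Rmin; repeat destruct Rle_dec; lra. Qed.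

Lemma clamp_id a b x : a <= x <= b -> clamp a b x = x.
Proof. intros; unfold clamp, Rmax, Rmin; repeat destruct Rle_dec; lra. Qed.

Lemma clamp_lip a b x y : a <= b -> Rabs (clamp a b x - clamp a b y) <= Rabs (x - y).
Proof.
  intros; unfold clamp, Rmax, Rmin, Rabs;
    repeat destruct Rle_dec; repeat destruct Rcase_abs; lra.
Qed.

(** Continuity is relative to the interval. Composing with the 1-Lipschitz retraction [clamp] gives
    a function continuous on the whole line with the same integral. *)
Lemma cont_on_closed_ex_RInt h a b : a <= b -> cont_on_closed h a b -> ex_RInt h a b.
Proof.
  intros Hab Hc.
  apply ex_RInt_ext with (fun x => h (clamp a b x)).
  - intros x; rewrite Rmin_left, Rmax_right by lra; intros Hx.
    now rewrite clamp_id by lra.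
  - apply (@ex_RInt_continuous R_CompleteNormedModule); intros z _.
    apply continuity_pt_filterlim; intros eps Heps.
    destruct (Hc (clamp a b z) (clamp_in a b z Hab) eps Heps) as [d [Hd Hd']].
    exists d; split; [exact Hd|]; intros y [_ Hy].
    apply Hd'; [now apply clamp_in|].
    apply Rle_lt_trans with (2 := Hy); now apply clamp_lip.
Qed.

Lemma ex_RInt_sub (h : R -> R) a b c d :
  a <= c -> c <= d -> d <= b -> ex_RInt h a b -> ex_RInt h c d.
Proof.
  intros; apply (@ex_RInt_Chasles_2 R_CompleteNormedModule) with a; [lra|].
  apply (@ex_RInt_Chasles_1 R_CompleteNormedModule) with b; [lra|assumption].
Qed.

Lemma RInt_split (h : R -> R) a b c :
  ex_RInt h a b -> ex_RInt h b c -> RInt h a c = RInt h a b + RInt h b c.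
Proof.
  intros H1 H2; symmetry.
  exact (@RInt_Chasles R_CompleteNormedModule h a b c H1 H2).
Qed.

Lemma RInt_shift (h : R -> R) a b k :
  ex_RInt h (a + k) (b + k) -> RInt (fun s => h (s + k)) a b = RInt h (a + k) (b + k).
Proof.
  intros H.
  rewrite <- (Rmult_1_l a), <- (Rmult_1_l b) in H.
  pose proof (@RInt_comp_lin R_CompleteNormedModule h 1 k a b H) as E.
  rewrite !Rmult_1_l in E; rewrite <- E.
  apply RInt_ext; intros s _; unfold scal; simpl; unfold mult; simpl.
  now rewrite !Rmult_1_l.
Qed.

Lemma ex_RInt_shift (h : R -> R) a b k :
  ex_RInt h (a + k) (b + k) -> ex_RInt (fun s => h (s + k)) a b.
Proof.
  intros H.
  rewrite <- (Rmult_1_l a), <- (Rmult_1_l b) in H.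
  apply ex_RInt_ext with (2 := @ex_RInt_comp_lin R_NormedModule h 1 k a b H).
  intros s _; unfold scal; simpl; unfold mult; simpl.
  now rewrite !Rmult_1_l.
Qed.

Lemma RInt_ge_const (h : R -> R) a b c :
  a <= b -> ex_RInt h a b -> (forall s, a < s < b -> c <= h s) -> (b - a) * c <= RInt h a b.
Proof.
  intros Hab He Hh.
  assert (E : RInt (fun _ => c) a b = (b - a) * c) by exact (@RInt_const R_CompleteNormedModule a b c).
  rewrite <- E.
  apply RInt_le; auto; apply ex_RInt_const.
Qed.

Lemma RInt_le_const (h : R -> R) a b c :
  a <= b -> ex_RInt h a b -> (forall s, a < s < b -> h s <= c) -> RInt h a b <= (b - a) * c.
Proof.
  intros Hab He Hh.
  assert (E : RInt (fun _ => c) a b = (b - a) * c) by exact (@RInt_const R_CompleteNormedModule a b c).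
  rewrite <- E.
  apply RInt_le; auto; apply ex_RInt_const.
Qed.

Lemma RInt_sub (h1 h2 : R -> R) a b :
  ex_RInt h1 a b -> ex_RInt h2 a b ->
  RInt h1 a b - RInt h2 a b = RInt (fun s => h1 s - h2 s) a b.
Proof. intros; symmetry; exact (@RInt_minus R_CompleteNormedModule h1 h2 a b H H0). Qed.

Lemma ex_RInt_sub_fun (h1 h2 : R -> R) a b :
  ex_RInt h1 a b -> ex_RInt h2 a b -> ex_RInt (fun s => h1 s - h2 s) a b.
Proof. intros; exact (@ex_RInt_minus R_NormedModule h1 h2 a b H H0). Qed.

Lemma RInt_mult_l (h : R -> R) c a b :
  ex_RInt h a b -> RInt (fun s => c * h s) a b = c * RInt h a b.
Proof. intros; exact (@RInt_scal R_CompleteNormedModule h a b c H). Qed.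

Lemma ex_RInt_mult_l (h : R -> R) c a b :
  ex_RInt h a b -> ex_RInt (fun s => c * h s) a b.
Proof. intros; exact (@ex_RInt_scal R_NormedModule h a b c H). Qed.

Lemma is_RInt_exp kappa t : 0 < kappa ->
  is_RInt (fun s => exp (kappa * s)) 0 t (exp (kappa * t) / kappa - 1 / kappa).
Proof.
  intros Hk.
  replace (1 / kappa) with (exp (kappa * 0) / kappa) by (rewrite Rmult_0_r, exp_0; reflexivity).
  apply (@is_RInt_derive R_CompleteNormedModule (fun s => exp (kappa * s) / kappa)).
  - intros x _; auto_derive; [exact I|field; lra].
  - intros x _; apply (@ex_derive_continuous R_AbsRing R_NormedModule).
    auto_derive; exact I.
Qed.

(* The weight [exp (kappa s)] turns the Picard iteration into a contraction of ratio [1 / kappa]. *)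
Lemma RInt_le_exp (h : R -> R) C kappa c t :
  0 <= t -> 0 < kappa -> 0 <= C -> ex_RInt h 0 t ->
  (forall s, 0 < s < t -> h s <= C * exp (kappa * s) + c) ->
  RInt h 0 t <= C / kappa * exp (kappa * t) + t * c.
Proof.
  intros Ht Hk HC He Hh.
  pose proof (is_RInt_exp kappa t Hk) as Hexp.
  assert (E1 : ex_RInt (fun s => C * exp (kappa * s)) 0 t).
  { apply ex_RInt_mult_l; eexists; exact Hexp. }
  assert (E2 : ex_RInt (fun s => C * exp (kappa * s) + c) 0 t).
  { apply (@ex_RInt_plus R_NormedModule); [exact E1|apply ex_RInt_const]. }
  apply Rle_trans with (1 := RInt_le _ _ _ _ Ht He E2 Hh).
  replace (RInt (fun s => C * exp (kappa * s) + c) 0 t)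
    with (C * (exp (kappa * t) / kappa - 1 / kappa) + t * c).
  - assert (0 <= C * (1 / kappa)).
    { apply Rmult_le_pos; [lra|]; apply Rlt_le, Rdiv_lt_0_compat; lra. }
    unfold Rdiv in *; nra.
  - symmetry; apply is_RInt_unique.
    apply (@is_RInt_plus R_NormedModule).
    + apply (@is_RInt_scal R_NormedModule _ _ _ C _ Hexp).
    + replace (t * c) with ((t - 0) * c) by ring. exact (@is_RInt_const R_NormedModule 0 t c).
Qed.

Lemma RInt_abs_le_exp (h : R -> R) C kappa c t :
  0 <= t -> 0 < kappa -> 0 <= C -> ex_RInt h 0 t ->
  (forall s, 0 < s < t -> Rabs (h s) <= C * exp (kappa * s) + c) ->
  Rabs (RInt h 0 t) <= C / kappa * exp (kappa * t) + t * c.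
Proof.
  intros Ht Hk HC He Hh.
  assert (H1 : RInt h 0 t <= C / kappa * exp (kappa * t) + t * c).
  { apply RInt_le_exp; auto; intros s Hs.
    apply Rle_trans with (1 := Rle_abs _); auto. }
  assert (H2 : RInt (fun s => -1 * h s) 0 t <= C / kappa * exp (kappa * t) + t * c).
  { apply RInt_le_exp; auto; [now apply ex_RInt_mult_l|]; intros s Hs.
    specialize (Hh s Hs); revert Hh; unfold Rabs; destruct Rcase_abs; lra. }
  rewrite RInt_mult_l in H2 by assumption.
  apply Rabs_le; lra.
Qed.

(** Passage to the limit in every estimate that gains a factor 1/2 per iteration. *)
Lemma le_of_geometric a b C : (forall n, a <= b + C * (1 / 2) ^ n) -> a <= b.
Proof.
  intros H; apply Rnot_lt_le; intros Hab.
  destruct (pow_lt_1_zero (1 / 2)) with (y := (a - b) / (Rabs C + 1)) as [N HN].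
  - rewrite Rabs_pos_eq; lra.
  - apply Rdiv_lt_0_compat; [lra|]; pose proof (Rabs_pos C); lra.
  - specialize (HN N (le_n _)); specialize (H N).
    pose proof (Rabs_pos C); pose proof (Rle_abs C).
    assert (0 < (1 / 2) ^ N) by (apply pow_lt; lra).
    rewrite Rabs_pos_eq in HN by lra.
    apply Rmult_lt_compat_l with (r := Rabs C + 1) in HN; [|lra].
    replace ((Rabs C + 1) * ((a - b) / (Rabs C + 1))) with (a - b) in HN by (field; lra).
    nra.
Qed.

(** Cross-multiplying by the two steps cancels the linear parts [c k] and [c k'], so the slope [c]
    need not be known; the errors add up to [k' k^2 + k k'^2]. *)
Lemma cross_defect_le a a' c D k k' : 0 < k -> 0 < k' ->
  Rabs (a - c * k) <= D * k ^ 2 -> Rabs (a' - c * k') <= D * k' ^ 2 ->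
  Rabs (k' * a - k * a') <= D * (k * k' * (k + k')).
Proof.
  intros Hk Hk' H H'.
  replace (k' * a - k * a') with (k' * (a - c * k) - k * (a' - c * k')) by ring.
  unfold Rminus at 1; eapply Rle_trans; [apply Rabs_triang|].
  rewrite Rabs_Ropp, !Rabs_mult, (Rabs_pos_eq k), (Rabs_pos_eq k') by lra.
  apply Rmult_le_compat_l with (r := k') in H; [|lra].
  apply Rmult_le_compat_l with (r := k) in H'; [|lra].
  lra.
Qed.

Lemma Rabs_diff_le a b c : Rabs (a - b) <= c -> b - c <= a <= b + c.
Proof. unfold Rabs; destruct Rcase_abs; lra. Qed.

Lemma exp_ge_1 x : 0 <= x -> 1 <= exp x.
Proof.
  intros Hx; rewrite <- exp_0; destruct (Req_dec x 0) as [->|Hne]; [lra|].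
  apply Rlt_le, exp_increasing; lra.
Qed.

(** * Differentiability from difference quotients *)

Lemma is_derive_quotient h t l eta C :
  0 < eta ->
  (forall k, Rabs k < eta -> Rabs (h (t + k) - h t - k * l) <= C * k ^ 2) ->
  is_derive h t l.
Proof.
  intros Heta H; apply is_derive_Reals; intros eps Heps.
  assert (HC : 0 < Rabs C + 1) by (pose proof (Rabs_pos C); lra).
  assert (Hd : 0 < Rmin eta (eps / (Rabs C + 1))).
  { apply Rmin_pos; [lra|]; apply Rdiv_lt_0_compat; lra. }
  exists (mkposreal _ Hd); simpl; intros k Hk0 Hk.
  assert (Hk1 := Rlt_le_trans _ _ _ Hk (Rmin_l _ _)).
  assert (Hk2 := Rlt_le_trans _ _ _ Hk (Rmin_r _ _)).
  specialize (H k Hk1).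
  replace ((h (t + k) - h t) / k - l) with ((h (t + k) - h t - k * l) / k) by (field; auto).
  assert (Hkp := Rabs_pos_lt k Hk0).
  unfold Rdiv; rewrite Rabs_mult, Rabs_inv.
  apply Rmult_lt_reg_r with (Rabs k); [exact Hkp|].
  rewrite Rmult_assoc, Rinv_l, Rmult_1_r by lra.
  apply Rle_lt_trans with (1 := H).
  assert (Hkk : k ^ 2 = Rabs k * Rabs k).
  { rewrite <- Rabs_mult, Rabs_pos_eq; [ring|nra]. }
  rewrite Hkk.
  apply Rle_lt_trans with (Rabs C * Rabs k * Rabs k).
  { pose proof (Rle_abs C); pose proof (Rmult_lt_0_compat _ _ Hkp Hkp); nra. }
  apply Rmult_lt_compat_r; [exact Hkp|].
  apply Rmult_lt_compat_l with (r := Rabs C + 1) in Hk2; [|lra].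
  replace ((Rabs C + 1) * (eps / (Rabs C + 1))) with eps in Hk2 by (field; lra).
  pose proof (Rabs_pos C); nra.
Qed.

(* Right difference quotients that agree up to [O(k + k')], uniformly in the base point,
   have a limit [v s]; comparing the steps [k] and [2k] taken from [s - k] shows
   [v (s - k) = v s + O(k)], which handles the left quotients. *)
Lemma ex_derive_uniform_quotients h S eta C t :
  0 < eta -> 0 <= C ->
  (forall s k k', 0 <= s < S -> 0 < k <= eta -> 0 < k' <= eta ->
     Rabs (k' * (h (s + k) - h s) - k * (h (s + k') - h s)) <= C * (k * k' * (k + k'))) ->
  0 < t < S -> ex_derive h t.
Proof.
  intros Heta HC H Ht.
  set (Q := fun s k => (h (s + k) - h s) / k).
  assert (HQ : forall s k k', 0 <= s < S -> 0 < k <= eta -> 0 < k' <= eta ->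
            Rabs (Q s k - Q s k') <= C * (k + k')).
  { intros s k k' Hs Hk Hk'; specialize (H s k k' Hs Hk Hk'); unfold Q.
    replace ((h (s + k) - h s) / k - (h (s + k') - h s) / k')
      with ((k' * (h (s + k) - h s) - k * (h (s + k') - h s)) / (k * k')) by (field; lra).
    assert (0 < k * k') by (apply Rmult_lt_0_compat; lra).
    unfold Rdiv; rewrite Rabs_mult, Rabs_inv, (Rabs_pos_eq (k * k')) by lra.
    apply Rmult_le_reg_r with (k * k'); [lra|].
    rewrite Rmult_assoc, Rinv_l, Rmult_1_r by lra; lra. }
  set (kn := fun n : nat => eta / INR (n + 1)).
  assert (Hkn : forall n, 0 < kn n <= eta).
  { intros n; unfold kn; assert (1 <= INR (n + 1)).
    { rewrite plus_INR; simpl; pose proof (pos_INR n); lra. }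
    split; [apply Rdiv_lt_0_compat; lra|].
    apply Rmult_le_reg_r with (INR (n + 1)); [lra|].
    unfold Rdiv; rewrite Rmult_assoc, Rinv_l by lra; nra. }
  assert (Hk0 : forall e, 0 < e -> exists N, forall n, (N <= n)%nat -> kn n < e).
  { intros e He; destruct (archimed_cor1 (e / eta)) as [N [HN HN0]].
    { apply Rdiv_lt_0_compat; lra. }
    exists N; intros n Hn; unfold kn.
    assert (0 < INR N) by (apply lt_0_INR; lia).
    assert (INR N <= INR (n + 1)) by (apply le_INR; lia).
    apply Rmult_lt_reg_r with (INR (n + 1)); [lra|].
    unfold Rdiv; rewrite Rmult_assoc, Rinv_l, Rmult_1_r by lra.
    apply Rmult_lt_compat_r with (r := INR N * eta) in HN; [|nra].
    replace (/ INR N * (INR N * eta)) with eta in HN by (field; lra).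
    replace (e / eta * (INR N * eta)) with (e * INR N) in HN by (field; lra).
    nra. }
  assert (Hv : forall s, exists v, 0 <= s < S ->
            forall k, 0 < k <= eta -> Rabs (h (s + k) - h s - k * v) <= C * k ^ 2).
  { intros s.
    destruct (Rlt_dec s S) as [HsS|HsS]; [|exists 0; lra].
    destruct (Rle_dec 0 s) as [Hs0|Hs0]; [|exists 0; lra].
    assert (Hs : 0 <= s < S) by lra; clear HsS Hs0.
    destruct (Rcomplete.R_complete (fun n => Q s (kn n))) as [v Hv].
    { intros e He; destruct (Hk0 (e / (2 * C + 1))) as [N HN].
      { apply Rdiv_lt_0_compat; lra. }
      exists N; intros n m Hn Hm; unfold Rdist.
      apply Rle_lt_trans with (1 := HQ s _ _ Hs (Hkn n) (Hkn m)).
      pose proof (HN n Hn); pose proof (HN m Hm).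
      pose proof (Hkn n); pose proof (Hkn m).
      apply Rle_lt_trans with ((2 * C) * (e / (2 * C + 1))); [nra|].
      apply Rmult_lt_reg_r with (2 * C + 1); [lra|].
      unfold Rdiv; rewrite !Rmult_assoc, Rinv_l, Rmult_1_r by lra; nra. }
    exists v; intros _ k Hk.
    assert (Hq : Rabs (Q s k - v) <= C * k).
    { apply Rnot_lt_le; intros Hlt.
      set (e := (Rabs (Q s k - v) - C * k) / (C + 2)).
      assert (He : 0 < e) by (apply Rdiv_lt_0_compat; lra).
      destruct (Hv e He) as [N1 HN1]; destruct (Hk0 e He) as [N2 HN2].
      set (n := (N1 + N2)%nat).
      specialize (HN1 n ltac:(unfold n; lia)); specialize (HN2 n ltac:(unfold n; lia)).
      unfold Rdist in HN1.
      pose proof (HQ s k (kn n) Hs Hk (Hkn n)) as H1.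
      pose proof (Rabs_triang (Q s k - Q s (kn n)) (Q s (kn n) - v)) as H2.
      replace (Q s k - Q s (kn n) + (Q s (kn n) - v)) with (Q s k - v) in H2 by ring.
      assert (H3 : e * (C + 2) = Rabs (Q s k - v) - C * k) by (unfold e; field; lra).
      pose proof (Hkn n); nra. }
    replace (h (s + k) - h s - k * v) with ((Q s k - v) * k) by (unfold Q; field; lra).
    rewrite Rabs_mult, (Rabs_pos_eq k) by lra; nra. }
  destruct (Hv t) as [v Hvt].
  exists v.
  set (eta' := Rmin (eta / 2) (Rmin t (S - t))).
  assert (Heta' : 0 < eta') by (unfold eta'; repeat apply Rmin_pos; lra).
  assert (He1 : eta' <= eta / 2) by apply Rmin_l.
  assert (He2 : eta' <= t) by (eapply Rle_trans; [apply Rmin_r|apply Rmin_l]).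
  (* Eliminating the slope [w] at [t - j] between the steps [j] and [2 j] costs [(2 + 4) C j^2], and
     the right quotient at [t] one more [C j^2]; hence [8 C]. The bounds on [eta'] keep [t - j]
     nonnegative and [2 j] at most [eta]. *)
  apply is_derive_quotient with eta' (8 * C); [exact Heta'|].
  intros k Hk.
  assert (Hk2 : 0 <= k ^ 2) by (simpl; nra).
  destruct (Rtotal_order k 0) as [Hneg|[H0|Hpos]].
  - rewrite Rabs_left in Hk by lra.
    set (j := - k); assert (Hj : 0 < j < eta') by (unfold j; lra).
    destruct (Hv (t - j)) as [w Hw].
    specialize (Hw ltac:(lra)).
    pose proof (Hw j ltac:(lra)) as W1; pose proof (Hw (2 * j) ltac:(lra)) as W2.
    pose proof (Hvt ltac:(lra) j ltac:(lra)) as W3.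
    replace (t - j + j) with t in W1 by ring.
    replace (t - j + 2 * j) with (t + j) in W2 by ring.
    replace k with (- j) by (unfold j; ring).
    replace (t + - j) with (t - j) by ring.
    assert (0 <= C * j ^ 2) by (apply Rmult_le_pos; [lra|simpl; nra]).
    revert W1 W2 W3; unfold Rabs; repeat destruct Rcase_abs; nra.
  - subst k; rewrite Rplus_0_r; replace (h t - h t - 0 * v) with 0 by ring.
    rewrite Rabs_R0; nra.
  - rewrite Rabs_pos_eq in Hk by lra.
    apply Rle_trans with (1 := Hvt ltac:(lra) k ltac:(lra)); nra.
Qed.

Lemma is_derive_ge_right h t l c d : is_derive h t l -> 0 < d ->
  (forall k, 0 < k < d -> c * k <= h (t + k) - h t) -> c <= l.
Proof.
  intros Hl Hd H; apply Rnot_lt_le; intros Hlt.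
  apply is_derive_Reals in Hl; destruct (Hl (c - l)) as [[d' Hd'] H']; [lra|simpl in H'].
  set (k := Rmin d d' / 2).
  assert (Hk : 0 < Rmin d d') by now apply Rmin_pos.
  pose proof (Rmin_l d d'); pose proof (Rmin_r d d').
  specialize (H k ltac:(unfold k; lra)).
  specialize (H' k ltac:(unfold k; lra)); rewrite Rabs_pos_eq in H' by (unfold k; lra).
  specialize (H' ltac:(unfold k; lra)).
  assert (c <= (h (t + k) - h t) / k).
  { apply Rmult_le_reg_r with k; [unfold k; lra|].
    unfold Rdiv; rewrite Rmult_assoc, Rinv_l by (unfold k; lra); lra. }
  revert H'; unfold Rabs; destruct Rcase_abs; lra.
Qed.

Lemma is_derive_le_right h t l c d : is_derive h t l -> 0 < d ->
  (forall k, 0 < k < d -> h (t + k) - h t <= c * k) -> l <= c.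
Proof.
  intros Hl Hd H.
  assert (- c <= - l); [|lra].
  apply is_derive_ge_right with (fun x => - h x) t d; [|exact Hd|].
  - exact (@is_derive_opp R_AbsRing R_NormedModule h t l Hl).
  - intros k Hk; specialize (H k Hk); lra.
Qed.

(** * The nonlinearity *)

Lemma Rpower_pos x r : 0 < Rpower x r.
Proof. apply exp_pos. Qed.

(** The power is monotone in one direction or the other according to the sign of [r]; the sum of the
    two end values covers both cases. *)
Lemma Rpower_le_between r c M x : 0 < c -> c <= x <= M -> Rpower x r <= Rpower c r + Rpower M r.
Proof.
  intros Hc Hx; pose proof (Rpower_pos c r); pose proof (Rpower_pos M r).
  destruct (Rle_dec 0 r) as [Hr|Hr].
  - assert (Rpower x r <= Rpower M r) by (apply Rle_Rpower_l; lra); lra.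
  - assert (Rpower x r <= Rpower c r); [|lra].
    replace r with (- - r) by ring; rewrite (Rpower_Ropp x), (Rpower_Ropp c).
    apply Rinv_le_contravar; [apply Rpower_pos|apply Rle_Rpower_l; lra].
Qed.

Lemma Rpower_mean_value r a b : 0 < a -> 0 < b -> exists c,
  Rmin a b <= c <= Rmax a b /\ Rpower b r - Rpower a r = r * Rpower c (r - 1) * (b - a).
Proof.
  intros Ha Hb.
  assert (Hm : 0 < Rmin a b) by (apply Rmin_pos; lra).
  assert (D : forall x, Rmin a b <= x -> is_derive (fun x => Rpower x r) x (r * Rpower x (r - 1))).
  { intros x Hx; apply is_derive_Reals, derivable_pt_lim_power; lra. }
  apply (MVT_gen (fun x => Rpower x r) a b (fun x => r * Rpower x (r - 1))).
  - intros x Hx; apply D; lra.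
  - intros x Hx; apply derivable_continuous_pt.
    exists (r * Rpower x (r - 1)); apply is_derive_Reals, D; lra.
Qed.

Lemma Rpower_lipschitz r c M a b : 0 < c -> c <= a <= M -> c <= b <= M ->
  Rabs (Rpower b r - Rpower a r) <= Rabs r * (Rpower c (r - 1) + Rpower M (r - 1)) * Rabs (b - a).
Proof.
  intros Hc Ha Hb; destruct (Rpower_mean_value r a b) as [x [Hx E]]; [lra|lra|].
  rewrite E, !Rabs_mult; apply Rmult_le_compat_r; [apply Rabs_pos|].
  apply Rmult_le_compat_l; [apply Rabs_pos|].
  rewrite Rabs_pos_eq by (apply Rlt_le, Rpower_pos).
  apply Rpower_le_between; [lra|]; revert Hx; unfold Rmin, Rmax; destruct Rle_dec; lra.
Qed.

Lemma Rpower_taylor r c M : 0 < c -> exists K, 0 <= K /\ forall a b, c <= a <= M -> c <= b <= M ->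
  Rabs (Rpower b r - Rpower a r - r * Rpower a (r - 1) * (b - a)) <= K * (b - a) ^ 2.
Proof.
  intros Hc.
  set (K0 := Rabs (r - 1) * (Rpower c (r - 1 - 1) + Rpower M (r - 1 - 1))).
  exists (Rabs r * K0); split.
  { pose proof (Rpower_pos c (r - 1 - 1)); pose proof (Rpower_pos M (r - 1 - 1)).
    unfold K0; repeat apply Rmult_le_pos; try apply Rabs_pos; lra. }
  intros a b Ha Hb; destruct (Rpower_mean_value r a b) as [x [Hx E]]; [lra|lra|].
  rewrite E.
  assert (Hx' : c <= x <= M) by (revert Hx; unfold Rmin, Rmax; destruct Rle_dec; lra).
  pose proof (Rpower_lipschitz (r - 1) c M a x Hc Ha Hx') as HL; fold K0 in HL.
  assert (Hxa : Rabs (x - a) <= Rabs (b - a)).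
  { revert Hx; unfold Rmin, Rmax; destruct Rle_dec; unfold Rabs; repeat destruct Rcase_abs; lra. }
  replace (r * Rpower x (r - 1) * (b - a) - r * Rpower a (r - 1) * (b - a))
    with (r * (Rpower x (r - 1) - Rpower a (r - 1)) * (b - a)) by ring.
  rewrite !Rabs_mult.
  replace ((b - a) ^ 2) with (Rabs (b - a) * Rabs (b - a))
    by (rewrite <- (pow2_abs (b - a)); ring).
  rewrite <- Rmult_assoc; apply Rmult_le_compat_r; [apply Rabs_pos|].
  rewrite Rmult_assoc; apply Rmult_le_compat_l; [apply Rabs_pos|].
  apply Rle_trans with (1 := HL).
  apply Rmult_le_compat_l; [|exact Hxa].
  pose proof (Rpower_pos c (r - 1 - 1)); pose proof (Rpower_pos M (r - 1 - 1)).
  unfold K0; apply Rmult_le_pos; try apply Rabs_pos; lra.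
Qed.

(** What the analysis of the iterates needs from the source term. In [nl_taylor], [A] and [B] stand
    for the partial derivatives of [F] at [(a, s)], and the increments [b - a] of size [Lam k] are
    those of a Lipschitz function over a time [k]. *)
Record increasing_nonlinearity (F : R -> R -> R) (gam : R) : Prop := {
  nl_mono : forall a b s s', gam <= a <= b -> 0 <= s <= s' -> F a s <= F b s';
  nl_pos : 0 <= F gam 0;
  nl_lip : forall M, exists L, 0 < L /\ forall a b s s',
    gam <= a <= M -> gam <= b <= M -> 0 <= s -> 0 <= s' ->
    Rabs (F b s' - F a s) <= L * (Rabs (b - a) + Rabs (s' - s));
  nl_taylor : forall M Lam, 0 <= Lam -> exists L C, 0 < L /\ 0 <= C /\ forall a s,
    gam <= a <= M -> 0 <= s -> exists A B, Rabs A <= L /\ forall b k,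
      gam <= b <= M -> 0 < k -> Rabs (b - a) <= Lam * k ->
      Rabs (F b (s + k) - F a s - A * (b - a) - B * k) <= C * k ^ 2
}.

Definition source (p mu w s : R) : R :=
  Rpower 2 (- p) * powabs w p - mu / (1 + s) * (w / 2).

Lemma powabs_pos w a : 0 < w -> powabs w a = Rpower w a.
Proof.
  intros Hw; unfold powabs; rewrite (Rabs_pos_eq w) by lra.
  destruct Rlt_dec; [reflexivity|lra].
Qed.

Lemma Rpower_split w p : 0 < w -> Rpower w p = Rpower w (p - 1) * w.
Proof.
  intros Hw; rewrite <- (Rpower_1 w Hw) at 3; rewrite <- Rpower_plus; f_equal; ring.
Qed.

Section Source.
Context (p mu gam : R) (Hp : 1 < p) (Hmu : 0 < mu) (Hgam : 0 < gam)
  (Hdom : mu <= Rpower 2 (- p) * Rpower gam (p - 1)).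

Lemma damping_le_power w : gam <= w -> mu * w <= Rpower 2 (- p) * Rpower w p.
Proof.
  intros Hw; rewrite (Rpower_split w p) by lra.
  assert (Rpower gam (p - 1) <= Rpower w (p - 1)) by (apply Rle_Rpower_l; lra).
  pose proof (Rpower_pos 2 (- p)); rewrite <- Rmult_assoc.
  apply Rmult_le_compat_r; [lra|].
  apply Rle_trans with (1 := Hdom); apply Rmult_le_compat_l; lra.
Qed.

Lemma damping_coef_le s : 0 <= s -> 0 < mu / (1 + s) <= mu.
Proof.
  intros Hs; split; [apply Rdiv_lt_0_compat; lra|].
  apply Rmult_le_reg_r with (1 + s); [lra|].
  unfold Rdiv; rewrite Rmult_assoc, Rinv_l by lra; nra.
Qed.

(** By [damping_le_power] the damping [mu w / (2 (1 + s))] is at most half of the power term, whence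
    the factor 1/2. *)
Lemma source_lower w s : gam <= w -> 0 <= s ->
  / 2 * Rpower 2 (- p) * Rpower w p <= source p mu w s.
Proof.
  intros Hw Hs; unfold source; rewrite powabs_pos by lra.
  pose proof (damping_le_power w Hw); pose proof (damping_coef_le s Hs); nra.
Qed.

Lemma source_upper w s : gam <= w -> 0 <= s ->
  source p mu w s <= Rpower 2 (- p) * Rpower w p.
Proof.
  intros Hw Hs; unfold source; rewrite powabs_pos by lra.
  pose proof (damping_coef_le s Hs); nra.
Qed.

(** In [w], the slope [p 2^(-p) c^(p-1)] of the power term is at least [mu] for [c >= gam], more
    than the slope of the damping. In [s], the damping coefficient decreases. *)
Lemma source_increasing a b s s' : gam <= a <= b -> 0 <= s <= s' ->
  source p mu a s <= source p mu b s'.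
Proof.
  intros Hab Hs; unfold source; rewrite !powabs_pos by lra.
  destruct (Rpower_mean_value p a b) as [c [Hc E]]; [lra|lra|].
  rewrite Rmin_left, Rmax_right in Hc by lra.
  assert (Rpower gam (p - 1) <= Rpower c (p - 1)) by (apply Rle_Rpower_l; lra).
  pose proof (Rpower_pos 2 (- p)); pose proof (Rpower_pos c (p - 1)).
  pose proof (damping_coef_le s ltac:(lra)); pose proof (damping_coef_le s' ltac:(lra)).
  assert (mu / (1 + s') <= mu / (1 + s)).
  { unfold Rdiv; apply Rmult_le_compat_l; [lra|]; apply Rinv_le_contravar; lra. }
  assert (mu <= Rpower 2 (- p) * (p * Rpower c (p - 1))).
  { apply Rle_trans with (1 := Hdom); apply Rmult_le_compat_l; nra. }
  assert (mu * (b - a) <= Rpower 2 (- p) * (Rpower b p - Rpower a p)).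
  { rewrite E, <- Rmult_assoc; apply Rmult_le_compat_r; [lra|]; lra. }
  nra.
Qed.

Lemma damping_diff a b s s' : 0 <= s -> 0 <= s' ->
  mu / (1 + s') * (b / 2) - mu / (1 + s) * (a / 2)
  = mu / 2 * ((b - a) * / (1 + s') + a * (s - s') * (/ (1 + s) * / (1 + s'))).
Proof. intros; field; lra. Qed.

Lemma inv_1p_bounds s : 0 <= s -> 0 < / (1 + s) <= 1.
Proof.
  intros; split; [apply Rinv_0_lt_compat; lra|].
  rewrite <- Rinv_1; apply Rinv_le_contravar; lra.
Qed.

Lemma source_lipschitz M : exists L, 0 < L /\ forall a b s s',
  gam <= a <= M -> gam <= b <= M -> 0 <= s -> 0 <= s' ->
  Rabs (source p mu b s' - source p mu a s) <= L * (Rabs (b - a) + Rabs (s' - s)).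
Proof.
  pose proof (Rpower_pos 2 (- p)) as H2.
  pose proof (Rpower_pos gam (p - 1)); pose proof (Rpower_pos M (p - 1)).
  set (K := Rpower 2 (- p) * (Rabs p * (Rpower gam (p - 1) + Rpower M (p - 1)))).
  assert (HK : 0 <= K).
  { unfold K; repeat apply Rmult_le_pos; try apply Rabs_pos; lra. }
  exists (K + mu / 2 * (1 + Rabs M)).
  pose proof (Rabs_pos M).
  split; [nra|].
  intros a b s s' Ha Hb Hs Hs'; unfold source; rewrite !powabs_pos by lra.
  pose proof (Rpower_lipschitz p gam M a b Hgam Ha Hb) as HL.
  replace (Rpower 2 (- p) * Rpower b p - mu / (1 + s') * (b / 2)
           - (Rpower 2 (- p) * Rpower a p - mu / (1 + s) * (a / 2)))
    with (Rpower 2 (- p) * (Rpower b p - Rpower a p)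
          - (mu / (1 + s') * (b / 2) - mu / (1 + s) * (a / 2))) by ring.
  rewrite damping_diff by assumption.
  set (X := Rpower b p - Rpower a p) in *.
  pose proof (inv_1p_bounds s Hs); pose proof (inv_1p_bounds s' Hs').
  set (i := / (1 + s)) in *; set (j := / (1 + s')) in *.
  unfold Rminus at 1; eapply Rle_trans; [apply Rabs_triang|].
  rewrite Rabs_Ropp, !Rabs_mult, (Rabs_pos_eq (Rpower 2 (- p))), (Rabs_pos_eq (mu / 2)) by lra.
  assert (Rpower 2 (- p) * Rabs X <= K * Rabs (b - a)).
  { unfold K; rewrite Rmult_assoc; apply Rmult_le_compat_l; lra. }
  assert (Rabs ((b - a) * j + a * (s - s') * (i * j)) <= Rabs (b - a) + Rabs M * Rabs (s' - s)).
  { eapply Rle_trans; [apply Rabs_triang|]; rewrite !Rabs_mult.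
    rewrite (Rabs_pos_eq i), (Rabs_pos_eq j), (Rabs_pos_eq a), (Rabs_minus_sym s s') by lra.
    pose proof (Rabs_pos (b - a)); pose proof (Rabs_pos (s' - s)); pose proof (Rle_abs M).
    assert (i * j <= 1) by nra. assert (0 <= i * j) by nra.
    assert (a * Rabs (s' - s) * (i * j) <= a * Rabs (s' - s) * 1)
      by (apply Rmult_le_compat_l; [apply Rmult_le_pos; lra|lra]).
    assert (a * Rabs (s' - s) <= Rabs M * Rabs (s' - s)) by (apply Rmult_le_compat_r; lra).
    assert (Rabs (b - a) * j <= Rabs (b - a) * 1) by (apply Rmult_le_compat_l; lra).
    lra. }
  pose proof (Rabs_pos (b - a)); pose proof (Rabs_pos (s' - s)).
  assert (mu / 2 * Rabs ((b - a) * j + a * (s - s') * (i * j))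
          <= mu / 2 * (Rabs (b - a) + Rabs M * Rabs (s' - s)))
    by (apply Rmult_le_compat_l; lra).
  assert (0 <= K * Rabs (s' - s)) by (apply Rmult_le_pos; lra).
  assert (0 <= mu / 2 * Rabs (s' - s)) by (apply Rmult_le_pos; lra).
  assert (0 <= mu / 2 * (Rabs M * Rabs (b - a))) by (repeat apply Rmult_le_pos; lra).
  lra.
Qed.

Lemma source_taylor M Lam : 0 <= Lam -> exists L C, 0 < L /\ 0 <= C /\ forall a s,
  gam <= a <= M -> 0 <= s -> exists A B, Rabs A <= L /\ forall b k,
    gam <= b <= M -> 0 < k -> Rabs (b - a) <= Lam * k ->
    Rabs (source p mu b (s + k) - source p mu a s - A * (b - a) - B * k) <= C * k ^ 2.
Proof.
  intros HLam.
  pose proof (Rpower_pos 2 (- p)) as H2.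
  pose proof (Rpower_pos gam (p - 1)) as Hg1; pose proof (Rpower_pos M (p - 1)) as HM1.
  destruct (Rpower_taylor p gam M Hgam) as [K [HK HKT]].
  exists (Rpower 2 (- p) * (p * (Rpower gam (p - 1) + Rpower M (p - 1))) + mu).
  exists (Rpower 2 (- p) * (K * Lam ^ 2) + mu / 2 * (Lam + Rabs M)).
  pose proof (Rabs_pos M) as HM0.
  split; [assert (0 < Rpower 2 (- p) * (p * (Rpower gam (p - 1) + Rpower M (p - 1))));
          [repeat apply Rmult_lt_0_compat; lra|lra]|].
  split.
  { assert (0 <= Rpower 2 (- p) * (K * Lam ^ 2)).
    { apply Rmult_le_pos; [lra|]; apply Rmult_le_pos; [lra|]; apply pow2_ge_0. }
    assert (0 <= mu / 2 * (Lam + Rabs M)) by (apply Rmult_le_pos; lra). lra. }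
  intros a s Ha Hs.
  (* The partial derivatives of [source] in [w] and in [s] at [(a, s)]. *)
  exists (Rpower 2 (- p) * (p * Rpower a (p - 1)) - mu / (1 + s) / 2), (mu / (1 + s) ^ 2 * (a / 2)).
  split.
  { pose proof (Rpower_le_between (p - 1) gam M a Hgam Ha).
    pose proof (damping_coef_le s Hs); pose proof (Rpower_pos a (p - 1)).
    assert (0 <= Rpower 2 (- p) * (p * Rpower a (p - 1))
            <= Rpower 2 (- p) * (p * (Rpower gam (p - 1) + Rpower M (p - 1)))).
    { split; [repeat apply Rmult_le_pos; lra|].
      repeat (apply Rmult_le_compat_l; [lra|]); lra. }
    apply Rabs_le; lra. }
  intros b k Hb Hk Hba; unfold source; rewrite !powabs_pos by lra.
  specialize (HKT a b Ha Hb).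
  set (X := Rpower b p - Rpower a p - p * Rpower a (p - 1) * (b - a)) in *.
  assert (Hi : 0 < / (1 + s) <= 1) by (apply inv_1p_bounds; lra).
  assert (Hj : 0 < / (1 + (s + k)) <= 1) by (apply inv_1p_bounds; lra).
  (* Second-order remainder of the damping: one summand carries [k (b - a)], the other [k^2], and
     [|b - a| <= Lam k]. *)
  set (Y := k * (/ (1 + s) * / (1 + (s + k))) * (b - a)
            - k * (/ (1 + s) * / (1 + (s + k))) * / (1 + s) * (a * k)).
  match goal with |- Rabs ?e <= _ =>
    replace e with (Rpower 2 (- p) * X + mu / 2 * Y) by (unfold X, Y; field; lra) end.
  eapply Rle_trans; [apply Rabs_triang|].
  rewrite !Rabs_mult, (Rabs_pos_eq (Rpower 2 (- p))), (Rabs_pos_eq (mu / 2)) by lra.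
  assert (HX : Rabs X <= K * Lam ^ 2 * k ^ 2).
  { apply Rle_trans with (1 := HKT).
    rewrite Rmult_assoc; apply Rmult_le_compat_l; [lra|].
    rewrite <- Rpow_mult_distr, <- (pow2_abs (b - a)).
    apply pow_incr; split; [apply Rabs_pos|lra]. }
  assert (HY : Rabs Y <= (Lam + Rabs M) * k ^ 2).
  { unfold Y; set (i := / (1 + s)) in *; set (j := / (1 + (s + k))) in *.
    assert (0 <= i * j <= 1) by nra.
    unfold Rminus at 1; eapply Rle_trans; [apply Rabs_triang|].
    rewrite Rabs_Ropp, !Rabs_mult.
    rewrite (Rabs_pos_eq i), (Rabs_pos_eq j), (Rabs_pos_eq k), (Rabs_pos_eq a) by lra.
    pose proof (Rle_abs M); pose proof (Rabs_pos (b - a)).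
    assert (k * (i * j) * Rabs (b - a) <= k * 1 * (Lam * k)).
    { apply Rmult_le_compat; try lra; [apply Rmult_le_pos; lra|].
      apply Rmult_le_compat_l; lra. }
    assert (k * (i * j) * i * (a * k) <= k * 1 * 1 * (Rabs M * k)).
    { assert (0 <= k * (i * j)) by (apply Rmult_le_pos; lra).
      apply Rmult_le_compat; [apply Rmult_le_pos; lra|apply Rmult_le_pos; lra| |].
      - apply Rmult_le_compat; try lra; apply Rmult_le_compat_l; lra.
      - apply Rmult_le_compat_r; lra. }
    simpl; lra. }
  apply Rmult_le_compat_l with (r := Rpower 2 (- p)) in HX; [|lra].
  apply Rmult_le_compat_l with (r := mu / 2) in HY; [|lra].
  lra.
Qed.

Lemma source_increasing_nonlinearity : increasing_nonlinearity (source p mu) gam.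
Proof.
  split.
  - intros; now apply source_increasing.
  - apply Rle_trans with (2 := source_lower gam 0 (Rle_refl _) (Rle_refl _)).
    pose proof (Rpower_pos 2 (- p)); pose proof (Rpower_pos gam p); nra.
  - exact source_lipschitz.
  - exact source_taylor.
Qed.

End Source.

(** * Monotonicity along cones *)

Ltac abs_lra := unfold Rabs in *; repeat destruct Rcase_abs; lra.

(** Backward light cone with apex [(X, T)]: open at the side, closed at the base [t = 0], and
    containing the characteristics that run from its points down to the base. *)
Definition cone (X T x t : R) : Prop := 0 <= t /\ Rabs (x - X) + t < T.

(** For differentiable [w] this is [d_t w >= lam |d_x w|], written with values so that it survives
    suprema. *)
Definition cone_mono (lam X T : R) (w : R -> R -> R) : Prop :=
  forall x t y s, cone X T x t -> cone X T y s ->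
  Rabs (y - x) <= lam * (s - t) -> w x t <= w y s.

(** The constants may depend on the point: enough for continuity, hence integrability, along
    characteristics. *)
Definition pointwise_lipschitz (X T : R) (w : R -> R -> R) : Prop :=
  forall x t, cone X T x t -> exists d L, 0 < d /\ 0 <= L /\
  forall y s, cone X T y s -> Rabs (y - x) < d -> Rabs (s - t) < d ->
  Rabs (w y s - w x t) <= L * (Rabs (y - x) + Rabs (s - t)).

Record admissible (gam lam X T : R) (w : R -> R -> R) : Prop := {
  adm_ge : forall x t, cone X T x t -> gam <= w x t;
  adm_mono : cone_mono lam X T w;
  adm_lip : pointwise_lipschitz X T w
}.

(* [e = 1] integrates along the characteristics of [D_-], [e = -1] along those of [D_+]. *)
Definition dir (e : R) : Prop := e = 1 \/ e = -1.

Definition step (F : R -> R -> R) (e : R) (h : R -> R) (w : R -> R -> R) (x t : R) : R :=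
  h (x + e * t) + RInt (fun s => F (w (x + e * (t - s)) s) s) 0 t.

Lemma cone_char X T x t e s : dir e -> cone X T x t -> 0 <= s <= t ->
  cone X T (x + e * (t - s)) s.
Proof. intros [->| ->] [H1 H2] H; split; try lra; abs_lra. Qed.

Lemma cone_sub X T X' T' x t : Rabs (X' - X) + T' <= T -> cone X' T' x t -> cone X T x t.
Proof. intros H [H1 H2]; split; [lra|abs_lra]. Qed.

Lemma cone_le X T T' x t : T' <= T -> cone X T' x t -> cone X T x t.
Proof. intros H [H1 H2]; split; lra. Qed.

Lemma admissible_sub gam lam X T X' T' w : Rabs (X' - X) + T' <= T ->
  admissible gam lam X T w -> admissible gam lam X' T' w.
Proof.
  intros H [H1 H2 H3]; assert (S : forall x t, cone X' T' x t -> cone X T x t)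
    by (intros x t; apply cone_sub, H).
  split.
  - intros x t Hc; apply H1, S, Hc.
  - intros x t y s Hc Hc'; apply H2; now apply S.
  - intros x t Hc; destruct (H3 x t (S _ _ Hc)) as [d [L [Hd [HL HH]]]].
    exists d, L; repeat split; auto.
Qed.

Lemma dir_abs e k : dir e -> Rabs (e * k) = Rabs k.
Proof. intros [->| ->]; [f_equal; ring|rewrite <- Rabs_Ropp; f_equal; ring]. Qed.

Section Step.
Context (F : R -> R -> R) (gam lam : R)
  (HF : increasing_nonlinearity F gam) (Hlam : 1 < lam).

Lemma source_on_char_continuous X T w x t e : admissible gam lam X T w ->
  dir e -> cone X T x t -> cont_on_closed (fun s => F (w (x + e * (t - s)) s) s) 0 t.
Proof.
  intros Hw He Hc s0 Hs0 eps Heps.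
  pose proof (cone_char X T x t e s0 He Hc Hs0) as C0.
  set (x0 := x + e * (t - s0)) in *.
  destruct (adm_lip _ _ _ _ _ Hw x0 s0 C0) as [d [L [Hd [HL H]]]].
  destruct (nl_lip _ _ HF (w x0 s0 + 1)) as [K [HK HKL]].
  assert (HP : 0 < 2 * L + 1) by lra.
  assert (HP2 : 0 < K * (2 * L + 1)) by nra.
  (* The three bounds serve, in order, to apply the Lipschitz estimate at [(x0, s0)], to keep [w]
     within 1 of its value there so that [K] is valid, and to reach [eps]. Moving along a
     characteristic changes [x] and [t] equally, whence [2 L]. *)
  exists (Rmin d (Rmin (/ (2 * L + 1)) (eps / (K * (2 * L + 1))))).
  split.
  { repeat apply Rmin_pos; [lra|apply Rinv_0_lt_compat; lra|apply Rdiv_lt_0_compat; lra]. }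
  intros s Hs Hd'.
  assert (D1 := Rlt_le_trans _ _ _ Hd' (Rmin_l _ _)).
  assert (D2 := Rlt_le_trans _ _ _ Hd' (Rle_trans _ _ _ (Rmin_r _ _) (Rmin_l _ _))).
  assert (D3 := Rlt_le_trans _ _ _ Hd' (Rle_trans _ _ _ (Rmin_r _ _) (Rmin_r _ _))).
  clear Hd'.
  pose proof (cone_char X T x t e s He Hc Hs) as C1.
  assert (Hxx : Rabs (x + e * (t - s) - x0) = Rabs (s - s0)).
  { unfold x0; replace (x + e * (t - s) - (x + e * (t - s0))) with (e * (s0 - s)) by ring.
    rewrite dir_abs by assumption; apply Rabs_minus_sym. }
  specialize (H _ _ C1); rewrite Hxx in H; specialize (H D1 D1).
  set (ws := w (x + e * (t - s)) s) in *.
  assert (E2 : (2 * L + 1) * Rabs (s - s0) < 1).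
  { apply Rmult_lt_compat_l with (r := 2 * L + 1) in D2; [|lra].
    rewrite Rinv_r in D2 by lra; exact D2. }
  assert (E3 : K * (2 * L + 1) * Rabs (s - s0) < eps).
  { apply Rmult_lt_compat_l with (r := K * (2 * L + 1)) in D3; [|lra].
    replace (K * (2 * L + 1) * (eps / (K * (2 * L + 1)))) with eps in D3 by (field; lra).
    exact D3. }
  pose proof (Rabs_pos (s - s0)).
  assert (Hb : Rabs (ws - w x0 s0) <= 1) by lra.
  pose proof (adm_ge _ _ _ _ _ Hw _ _ C0); pose proof (adm_ge _ _ _ _ _ Hw _ _ C1).
  fold ws in H2.
  apply Rle_lt_trans with (K * (Rabs (ws - w x0 s0) + Rabs (s - s0))).
  - apply HKL; try lra; split; try lra; abs_lra.
  - apply Rle_lt_trans with (2 := E3); rewrite Rmult_assoc.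
    apply Rmult_le_compat_l; lra.
Qed.

Lemma source_on_char_ex_RInt X T w x t e a b : admissible gam lam X T w ->
  dir e -> cone X T x t -> 0 <= a -> a <= b -> b <= t ->
  ex_RInt (fun s => F (w (x + e * (t - s)) s) s) a b.
Proof.
  intros Hw He Hc Ha Hab Hb; apply ex_RInt_sub with 0 t; try lra.
  apply cont_on_closed_ex_RInt; [lra|now apply source_on_char_continuous with X T].
Qed.

(** Both points lie on one characteristic: the foot and the integrand coincide, only the interval of
    integration grows. *)
Lemma step_along_char X T w e h x t k : admissible gam lam X T w -> dir e ->
  0 <= t -> 0 <= k -> cone X T (x - e * k) (t + k) ->
  step F e h w (x - e * k) (t + k)
  = step F e h w x t + RInt (fun s => F (w (x + e * (t - s)) s) s) t (t + k).
Proof.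
  intros Hw He Ht Hk Hc; unfold step.
  replace (x - e * k + e * (t + k)) with (x + e * t) by ring.
  rewrite (RInt_split _ 0 t (t + k)).
  - rewrite <- Rplus_assoc; f_equal; [f_equal|]; apply RInt_ext; intros s _; do 2 f_equal; ring.
  - apply source_on_char_ex_RInt with X T; auto; lra.
  - apply source_on_char_ex_RInt with X T; auto; lra.
Qed.

(** Cuts the integral at time [k] and translates the upper part to [[0, t]], so that values at times
    [t] and [t + k] are compared by integrals over one interval. *)
Lemma step_shift X T w e h x t k : admissible gam lam X T w -> dir e ->
  0 <= t -> 0 <= k -> cone X T x (t + k) ->
  step F e h w x (t + k) = step F e h w (x + e * t) k
    + RInt (fun s => F (w (x + e * (t - s)) (s + k)) (s + k)) 0 t.
Proof.
  intros Hw He Ht Hk Hc; unfold step.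
  rewrite (RInt_split _ 0 k (t + k)).
  - replace (x + e * (t + k)) with (x + e * t + e * k) by ring.
    rewrite <- Rplus_assoc; f_equal.
    + f_equal; apply RInt_ext; intros s _; do 2 f_equal; ring.
    + pose proof (RInt_shift (fun s => F (w (x + e * (t + k - s)) s) s) 0 t k) as E.
      rewrite Rplus_0_l in E; rewrite <- E.
      * apply RInt_ext; intros s _; do 2 f_equal; ring.
      * apply source_on_char_ex_RInt with X T; auto; lra.
  - apply source_on_char_ex_RInt with X T; auto; lra.
  - apply source_on_char_ex_RInt with X T; auto; lra.
Qed.

Lemma ex_RInt_source_shifted X T w e x t k : admissible gam lam X T w -> dir e ->
  0 <= t -> 0 <= k -> cone X T x (t + k) ->
  ex_RInt (fun s => F (w (x + e * (t - s)) (s + k)) (s + k)) 0 t.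
Proof.
  intros Hw He Ht Hk Hc.
  pose proof (ex_RInt_shift (fun s => F (w (x + e * (t + k - s)) s) s) 0 t k) as E.
  rewrite Rplus_0_l in E.
  apply ex_RInt_ext with (2 := E
    (source_on_char_ex_RInt X T w x (t + k) e k (t + k) Hw He Hc Hk ltac:(lra) (Rle_refl _))).
  intros s _; do 2 f_equal; ring.
Qed.

Lemma step_ge X T w e h x t c : admissible gam lam X T w -> dir e ->
  (forall z, Rabs (z - X) < T -> c <= h z) -> cone X T x t ->
  c + t * F gam 0 <= step F e h w x t.
Proof.
  intros Hw He Hh Hc; unfold step.
  destruct (Hc) as [Ht Hx].
  apply Rplus_le_compat.
  - apply Hh; destruct He as [->| ->]; abs_lra.
  - replace (t * F gam 0) with ((t - 0) * F gam 0) by ring.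
    apply RInt_ge_const; [lra|apply source_on_char_ex_RInt with X T; auto; lra|].
    intros s Hs; apply (nl_mono _ _ HF); [|lra]; split; [lra|].
    apply (adm_ge _ _ _ _ _ Hw), cone_char; auto; lra.
Qed.

(* Splitting off the initial layer [0, s - t] of the larger time interval leaves two integrals
   over the same interval, compared by the monotonicity of [w]; the layer contributes
   [(s - t) F(gam, 0)], which dominates the variation of the datum. *)
Lemma step_mono X T w e h m : admissible gam lam X T w -> dir e ->
  (forall z z', Rabs (z - X) < T -> Rabs (z' - X) < T -> Rabs (h z - h z') <= m * Rabs (z - z')) ->
  0 <= m -> (1 + lam) * m <= F gam 0 ->
  cone_mono lam X T (step F e h w).
Proof.
  intros Hw He Hh Hm HmF x t y s Hx Hy Hxy.
  assert (Hst : 0 <= s - t).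
  { pose proof (Rabs_pos (y - x)); apply Rnot_lt_le; intros Hn; nra. }
  destruct (Hx) as [Ht Hx']; destruct (Hy) as [Hs Hy'].
  set (k := s - t) in *; replace s with (t + k) in * by (unfold k; ring).
  rewrite step_shift with X T w e h y t k; auto.
  unfold step at 1.
  assert (Hcy : cone X T (y + e * t) k).
  { replace (y + e * t) with (y + e * (t + k - k)) by ring; apply cone_char; auto; lra. }
  assert (I1 : h (x + e * t) <= step F e h w (y + e * t) k).
  { unfold step.
    assert (k * F gam 0 <= RInt (fun s => F (w (y + e * t + e * (k - s)) s) s) 0 k).
    { replace (k * F gam 0) with ((k - 0) * F gam 0) by ring.
      apply RInt_ge_const; [lra|apply source_on_char_ex_RInt with X T; auto; lra|].
      intros s0 Hs0; apply (nl_mono _ _ HF); [|lra]; split; [lra|].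
      apply (adm_ge _ _ _ _ _ Hw), cone_char; auto; lra. }
    (* The feet differ by at most [|y - x| + k <= (1 + lam) k]; the hypothesis on [(1 + lam) m] is
       made for this distance. *)
    assert (Hz : Rabs (h (x + e * t) - h (y + e * t + e * k)) <= m * ((1 + lam) * k)).
    { apply Rle_trans with (m * Rabs (x + e * t - (y + e * t + e * k))).
      - apply Hh; destruct He as [->| ->]; abs_lra.
      - apply Rmult_le_compat_l; [lra|].
        destruct He as [->| ->]; abs_lra. }
    assert (m * ((1 + lam) * k) <= k * F gam 0) by nra.
    abs_lra. }
  apply Rplus_le_compat; [exact I1|].
  apply RInt_le; [lra|apply source_on_char_ex_RInt with X T; auto; lra
                 |apply ex_RInt_source_shifted with X T; auto|].
  intros r Hr; apply (nl_mono _ _ HF); [|lra].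
  assert (C1 : cone X T (x + e * (t - r)) r) by (apply cone_char; auto; lra).
  split; [apply (adm_ge _ _ _ _ _ Hw); exact C1|].
  apply (adm_mono _ _ _ _ _ Hw); [exact C1| |].
  - replace (y + e * (t - r)) with (y + e * (t + k - (r + k))) by ring.
    apply cone_char; auto; lra.
  - replace (y + e * (t - r) - (x + e * (t - r))) with (y - x) by ring.
    replace (r + k - r) with k by ring; replace (t + k - t) with k in Hxy by ring; exact Hxy.
Qed.

(* Since [lam > 1], a point [(y, s)] close to [(x, t)] lies below the point reached from
   [(x, t)] by following a characteristic for a short time [k]. *)
Lemma step_speed X T w e h B x t y s k : admissible gam lam X T w -> dir e ->
  cone_mono lam X T (step F e h w) ->
  (forall x t, cone X T x t -> F (w x t) t <= B) ->
  0 <= t -> cone X T y s -> 0 <= k -> cone X T (x - e * k) (t + k) ->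
  Rabs (y - x) + lam * Rabs (s - t) <= (lam - 1) * k ->
  step F e h w y s <= step F e h w x t + k * B.
Proof.
  intros Hw He Hmono HB Ht Hy Hk Hc Hd.
  apply Rle_trans with (step F e h w (x - e * k) (t + k)).
  - apply Hmono; auto.
    assert (lam * (s - t) <= lam * Rabs (s - t)) by (apply Rmult_le_compat_l; [lra|apply Rle_abs]).
    assert (Rabs (x - e * k - y) <= Rabs (y - x) + k).
    { destruct He as [->| ->]; clear - Hk; abs_lra. }
    lra.
  - rewrite step_along_char with X T w e h x t k; auto.
    apply Rplus_le_compat_l.
    replace (k * B) with ((t + k - t) * B) by ring.
    apply RInt_le_const; [lra| |].
    + apply ex_RInt_ext with (fun r => F (w (x - e * k + e * (t + k - r)) r) r).
      * intros r _; do 2 f_equal; ring.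
      * apply source_on_char_ex_RInt with X T; auto; lra.
    + intros r Hr; apply HB.
      replace (x + e * (t - r)) with (x - e * k + e * (t + k - r)) by ring.
      apply cone_char; auto; lra.
Qed.

(** The light cone is narrower than the cone of slope [lam > 1], so every point of the cone below
    [(x, t)] precedes its apex. *)
Lemma cone_bound X T w x t : admissible gam lam X T w -> cone X T x t ->
  forall y s, cone x t y s -> gam <= w y s <= w x t.
Proof.
  intros Hw Hc y s Hy.
  assert (Cy : cone X T y s).
  { destruct Hc, Hy; split; [lra|abs_lra]. }
  split; [now apply (adm_ge _ _ _ _ _ Hw)|].
  apply (adm_mono _ _ _ _ _ Hw); auto.
  destruct Hy; rewrite Rabs_minus_sym.
  apply Rle_trans with (1 * (t - s)); [lra|].
  apply Rmult_le_compat_r; [|lra]; pose proof (Rabs_pos (y - x)); lra.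
Qed.

(** Regularity from monotonicity alone: [step_speed] is applied in both directions with [k] equal to
    [lam / (lam - 1)] times the distance, inside a smaller cone with apex [(x, t + rho)] whose apex
    value bounds [w]. *)
Lemma step_pointwise_lipschitz X T w e h : admissible gam lam X T w -> dir e ->
  cone_mono lam X T (step F e h w) -> pointwise_lipschitz X T (step F e h w).
Proof.
  intros Hw He Hmono x t Hc; destruct (Hc) as [Ht Hx].
  set (rho := (T - Rabs (x - X) - t) / 2).
  assert (Hrho : 0 < rho) by (unfold rho; lra).
  assert (Hsub : Rabs (x - X) + (t + rho) <= T) by (unfold rho; lra).
  assert (Ctop : cone X T x (t + rho)) by (split; [lra|unfold rho in *; lra]).
  pose proof (cone_bound X T w x (t + rho) Hw Ctop) as HM.
  set (B := F (w x (t + rho)) T).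
  assert (Hw' := admissible_sub _ _ _ _ x (t + rho) _ Hsub Hw).
  assert (Hmono' : cone_mono lam x (t + rho) (step F e h w)).
  { intros a b c d H1 H2; apply Hmono; now apply cone_sub with x (t + rho). }
  assert (HB : forall y s, cone x (t + rho) y s -> F (w y s) s <= B).
  { intros y s Hy; pose proof (HM y s Hy); unfold B; apply (nl_mono _ _ HF); [lra|].
    destruct Hy; pose proof (Rabs_pos (y - x)); pose proof (Rabs_pos (x - X)); lra. }
  assert (HB0 : 0 <= B).
  { apply Rle_trans with (1 := nl_pos _ _ HF); unfold B; apply (nl_mono _ _ HF).
    - split; [lra|]; apply (adm_ge _ _ _ _ _ Hw); exact Ctop.
    - pose proof (Rabs_pos (x - X)); lra. }
  (* Makes [4 k < rho] for all points within [d], so that the characteristics followed for the time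
     [k] stay in the smaller cone. *)
  set (d := rho * (lam - 1) / (8 * lam)).
  assert (Hd : 0 < d) by (unfold d; apply Rdiv_lt_0_compat; nra).
  assert (Hd8 : 8 * lam * d = rho * (lam - 1)) by (unfold d; field; lra).
  assert (Hdr : 8 * d <= rho) by nra.
  exists d, (lam / (lam - 1) * B); split; [exact Hd|]; split.
  { apply Rmult_le_pos; [|lra]; apply Rlt_le, Rdiv_lt_0_compat; lra. }
  intros y s Hy D1 D2.
  set (k := lam / (lam - 1) * (Rabs (y - x) + Rabs (s - t))).
  assert (Ek : (lam - 1) * k = lam * (Rabs (y - x) + Rabs (s - t))) by (unfold k; field; lra).
  pose proof (Rabs_pos (y - x)) as P1; pose proof (Rabs_pos (s - t)) as P2.
  assert (Hk : 0 <= k).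
  { unfold k; apply Rmult_le_pos; [|lra]; apply Rlt_le, Rdiv_lt_0_compat; lra. }
  assert (Hk4 : 4 * k < rho).
  { apply Rmult_lt_reg_l with (lam - 1); [lra|].
    replace ((lam - 1) * (4 * k)) with (4 * lam * (Rabs (y - x) + Rabs (s - t))) by lra.
    nra. }
  destruct Hy as [Hs0 Hy].
  assert (Cy : cone x (t + rho) y s) by (split; [lra|clear - D1 D2 Hdr Hd; abs_lra]).
  assert (Cx : cone x (t + rho) x t) by (split; [lra|rewrite Rminus_diag, Rabs_R0; lra]).
  assert (A1 : step F e h w y s <= step F e h w x t + k * B).
  { apply step_speed with x (t + rho); auto.
    - split; [lra|]; destruct He as [->| ->]; clear - Hk Hk4; abs_lra.
    - rewrite Ek; nra. }
  assert (A2 : step F e h w x t <= step F e h w y s + k * B).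
  { apply step_speed with x (t + rho); auto.
    - split; [lra|]; destruct He as [->| ->]; clear - Hk Hk4 D1 D2 Hdr Hd; abs_lra.
    - rewrite Ek, (Rabs_minus_sym x), (Rabs_minus_sym t); nra. }
  replace (lam / (lam - 1) * B * (Rabs (y - x) + Rabs (s - t))) with (k * B) by (unfold k; ring).
  apply Rabs_le; lra.
Qed.

End Step.

(** * Picard iterates and their limit *)

Definition total (a : (R -> R -> R) * (R -> R -> R)) (x t : R) : R := fst a x t + snd a x t.

Fixpoint picard (F : R -> R -> R) (f g : R -> R) (g1 g2 : R) (n : nat)
  : (R -> R -> R) * (R -> R -> R) :=
  match n with
  | O => (fun _ _ => g1, fun _ _ => g2)
  | S k => (step F 1 f (total (picard F f g g1 g2 k)), step F (-1) g (total (picard F f g g1 g2 k)))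
  end.

Record cauchy_data (f g : R -> R) (g1 g2 m X T : R) : Prop := {
  data_f_ge : forall z, Rabs (z - X) < T -> g1 <= f z;
  data_g_ge : forall z, Rabs (z - X) < T -> g2 <= g z;
  data_f_lip : forall z z', Rabs (z - X) < T -> Rabs (z' - X) < T ->
    Rabs (f z - f z') <= m * Rabs (z - z');
  data_g_lip : forall z z', Rabs (z - X) < T -> Rabs (z' - X) < T ->
    Rabs (g z - g z') <= m * Rabs (z - z')
}.

Lemma cauchy_data_sub f g g1 g2 m X T X' T' : Rabs (X' - X) + T' <= T ->
  cauchy_data f g g1 g2 m X T -> cauchy_data f g g1 g2 m X' T'.
Proof.
  intros H [H1 H2 H3 H4].
  assert (S : forall z, Rabs (z - X') < T' -> Rabs (z - X) < T) by (intros z Hz; abs_lra).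
  split; auto.
Qed.

Lemma dir_1 : dir 1.
Proof. now left. Qed.

Lemma dir_m1 : dir (-1).
Proof. now right. Qed.

Lemma pointwise_lipschitz_plus X T a b : pointwise_lipschitz X T a ->
  pointwise_lipschitz X T b -> pointwise_lipschitz X T (fun x t => a x t + b x t).
Proof.
  intros Ha Hb x t Hc.
  destruct (Ha x t Hc) as [d1 [L1 [Hd1 [HL1 H1]]]], (Hb x t Hc) as [d2 [L2 [Hd2 [HL2 H2]]]].
  exists (Rmin d1 d2), (L1 + L2); split; [now apply Rmin_pos|]; split; [lra|].
  intros y s Hy D1 D2.
  specialize (H1 y s Hy (Rlt_le_trans _ _ _ D1 (Rmin_l _ _)) (Rlt_le_trans _ _ _ D2 (Rmin_l _ _))).
  specialize (H2 y s Hy (Rlt_le_trans _ _ _ D1 (Rmin_r _ _)) (Rlt_le_trans _ _ _ D2 (Rmin_r _ _))).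
  replace (a y s + b y s - (a x t + b x t)) with (a y s - a x t + (b y s - b x t)) by ring.
  eapply Rle_trans; [apply Rabs_triang|]; lra.
Qed.

Section Picard.
Context (F : R -> R -> R) (f g : R -> R) (g1 g2 lam m : R)
  (HF : increasing_nonlinearity F (g1 + g2)) (Hlam : 1 < lam)
  (Hm : 0 <= m) (HmF : (1 + lam) * m <= F (g1 + g2) 0).

Let phi n := fst (picard F f g g1 g2 n).
Let psi n := snd (picard F f g g1 g2 n).
Let u n := total (picard F f g g1 g2 n).

Lemma admissible_total X T a :
  (forall x t, cone X T x t -> g1 <= fst a x t) -> (forall x t, cone X T x t -> g2 <= snd a x t) ->
  cone_mono lam X T (fst a) -> cone_mono lam X T (snd a) ->
  pointwise_lipschitz X T (fst a) -> pointwise_lipschitz X T (snd a) ->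
  admissible (g1 + g2) lam X T (total a).
Proof.
  intros; unfold total; split.
  - intros x t Hc; apply Rplus_le_compat; auto.
  - intros x t y s Hx Hy Hxy; apply Rplus_le_compat; auto.
  - now apply pointwise_lipschitz_plus.
Qed.

(** The properties feed one another: Lipschitz continuity of the sum makes the next integral exist,
    that integral inherits the monotonicity, and monotonicity gives back Lipschitz continuity. *)
Lemma picard_invariant X T (HD : cauchy_data f g g1 g2 m X T) n :
  (forall x t, cone X T x t -> g1 <= phi n x t) /\ (forall x t, cone X T x t -> g2 <= psi n x t) /\
  cone_mono lam X T (phi n) /\ cone_mono lam X T (psi n) /\
  pointwise_lipschitz X T (phi n) /\ pointwise_lipschitz X T (psi n).
Proof.
  induction n as [|n IH].
  - repeat split.
    + intros; apply Rle_refl.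
    + intros; apply Rle_refl.
    + intros x t y s _ _ _; apply Rle_refl.
    + intros x t y s _ _ _; apply Rle_refl.
    + intros x t _; exists 1, 0; repeat split; try lra.
      intros; unfold phi; simpl; rewrite Rminus_diag, Rabs_R0; lra.
    + intros x t _; exists 1, 0; repeat split; try lra.
      intros; unfold psi; simpl; rewrite Rminus_diag, Rabs_R0; lra.
  - destruct IH as [I1 [I2 [I3 [I4 [I5 I6]]]]].
    assert (A := admissible_total X T (picard F f g g1 g2 n) I1 I2 I3 I4 I5 I6).
    assert (M1 : cone_mono lam X T (phi (S n))).
    { apply (step_mono F (g1 + g2) lam HF) with m; auto using dir_1; apply HD. }
    assert (M2 : cone_mono lam X T (psi (S n))).
    { apply (step_mono F (g1 + g2) lam HF) with m; auto using dir_m1; apply HD. }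
    assert (HP := nl_pos _ _ HF).
    repeat split; auto.
    + intros x t Hc.
      pose proof (step_ge F (g1 + g2) lam HF X T _ 1 f x t g1 A dir_1 (data_f_ge _ _ _ _ _ _ _ HD) Hc).
      destruct Hc; unfold phi; simpl; nra.
    + intros x t Hc.
      pose proof (step_ge F (g1 + g2) lam HF X T _ (-1) g x t g2 A dir_m1 (data_g_ge _ _ _ _ _ _ _ HD) Hc).
      destruct Hc; unfold psi; simpl; nra.
    + apply (step_pointwise_lipschitz F (g1 + g2) lam); auto using dir_1.
    + apply (step_pointwise_lipschitz F (g1 + g2) lam); auto using dir_m1.
Qed.

Lemma picard_admissible X T (HD : cauchy_data f g g1 g2 m X T) n :
  admissible (g1 + g2) lam X T (u n).
Proof.
  destruct (picard_invariant X T HD n) as [I1 [I2 [I3 [I4 [I5 I6]]]]].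
  now apply admissible_total.
Qed.

Lemma step_le X T e h w w' x t : dir e -> cone X T x t ->
  admissible (g1 + g2) lam X T w -> admissible (g1 + g2) lam X T w' ->
  (forall y s, cone X T y s -> w y s <= w' y s) -> step F e h w x t <= step F e h w' x t.
Proof.
  intros He Hc Hw Hw' Hle; destruct (Hc) as [Ht _]; unfold step; apply Rplus_le_compat_l.
  apply RInt_le; [lra|apply (source_on_char_ex_RInt F (g1 + g2) lam HF) with X T; auto; lra
                 |apply (source_on_char_ex_RInt F (g1 + g2) lam HF) with X T; auto; lra|].
  intros s Hs; apply (nl_mono _ _ HF); [|lra].
  assert (C : cone X T (x + e * (t - s)) s) by (apply cone_char; auto; lra).
  split; [now apply (adm_ge _ _ _ _ _ Hw)|now apply Hle].
Qed.

Lemma picard_increasing X T (HD : cauchy_data f g g1 g2 m X T) n x t : cone X T x t ->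
  phi n x t <= phi (S n) x t /\ psi n x t <= psi (S n) x t.
Proof.
  revert x t; induction n as [|n IH]; intros x t Hc.
  - destruct (picard_invariant X T HD 1) as [I1 [I2 _]].
    split; [apply I1|apply I2]; exact Hc.
  - assert (L : forall y s, cone X T y s -> u n y s <= u (S n) y s).
    { intros y s Hy; destruct (IH y s Hy); now apply Rplus_le_compat. }
    split.
    + exact (step_le X T 1 f (u n) (u (S n)) x t dir_1 Hc
               (picard_admissible X T HD n) (picard_admissible X T HD (S n)) L).
    + exact (step_le X T (-1) g (u n) (u (S n)) x t dir_m1 Hc
               (picard_admissible X T HD n) (picard_admissible X T HD (S n)) L).
Qed.

Lemma picard_le X T (HD : cauchy_data f g g1 g2 m X T) n n' x t : (n <= n')%nat -> cone X T x t ->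
  phi n x t <= phi n' x t /\ psi n x t <= psi n' x t.
Proof.
  intros Hn Hc; induction Hn as [|k _ [IH1 IH2]]; [lra|].
  destruct (picard_increasing X T HD k x t Hc); lra.
Qed.

(** * The limit on a cone where the iterates are bounded *)

Section Limit.
(** [Phi] and [Psi] enter as real-valued least upper bounds on the cone only; the extended-real
    suprema are identified with them later, cone by cone. *)
Context (X T M : R) (HD : cauchy_data f g g1 g2 m X T)
  (HM : forall n x t, cone X T x t -> u n x t <= M) (Phi Psi : R -> R -> R)
  (Phi_ub : forall n x t, cone X T x t -> phi n x t <= Phi x t)
  (Psi_ub : forall n x t, cone X T x t -> psi n x t <= Psi x t)
  (Phi_lub : forall x t c, cone X T x t -> (forall n, phi n x t <= c) -> Phi x t <= c)
  (Psi_lub : forall x t c, cone X T x t -> (forall n, psi n x t <= c) -> Psi x t <= c).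

Let U := total (Phi, Psi).

Lemma limit_sum_le x t : cone X T x t -> U x t <= M.
Proof.
  intros Hc; unfold U, total; simpl.
  cut (Phi x t <= M - Psi x t); [lra|].
  apply Phi_lub; [exact Hc|]; intros n.
  cut (Psi x t <= M - phi n x t); [lra|].
  apply Psi_lub; [exact Hc|]; intros k.
  (* The two suprema have independent indices; both iterates are compared with those of the larger
     index. *)
  specialize (HM (max n k) x t Hc); unfold u, total in HM.
  destruct (picard_le X T HD n (max n k) x t ltac:(lia) Hc) as [H1 _].
  destruct (picard_le X T HD k (max n k) x t ltac:(lia) Hc) as [_ H2].
  unfold phi, psi in *; lra.
Qed.

Lemma picard_le_limit n x t : cone X T x t -> u n x t <= U x t.
Proof. intros Hc; apply Rplus_le_compat; [now apply Phi_ub|now apply Psi_ub]. Qed.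

Lemma limit_sum_ge x t : cone X T x t -> g1 + g2 <= U x t.
Proof. intros Hc; apply (picard_le_limit 0 x t Hc). Qed.

Lemma limit_cone_mono : cone_mono lam X T Phi /\ cone_mono lam X T Psi.
Proof.
  split; intros x t y s Hx Hy Hxy.
  - apply Phi_lub; [exact Hx|]; intros n.
    apply Rle_trans with (phi n y s); [|now apply Phi_ub].
    apply (picard_invariant X T HD n); auto.
  - apply Psi_lub; [exact Hx|]; intros n.
    apply Rle_trans with (psi n y s); [|now apply Psi_ub].
    apply (picard_invariant X T HD n); auto.
Qed.

Lemma source_picard_le n x t : cone X T x t -> F (u n x t) t <= F M T.
Proof.
  intros Hc; apply (nl_mono _ _ HF).
  - split; [now apply (adm_ge _ _ _ _ _ (picard_admissible X T HD n))|now apply HM].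
  - destruct Hc; pose proof (Rabs_pos (x - X)); lra.
Qed.

Lemma source_at_bound_pos x t : cone X T x t -> 0 <= F M T.
Proof.
  intros Hc; apply Rle_trans with (1 := nl_pos _ _ HF), (nl_mono _ _ HF).
  - split; [lra|exact (HM 0 x t Hc)].
  - destruct Hc; pose proof (Rabs_pos (x - X)); lra.
Qed.

(** The growth rate [F M T] bounds the source of every iterate, so [step_speed] holds uniformly in
    [n] and passes to the suprema. The margin [2 k] keeps [(x - e k, t + k)] in the cone. *)
Lemma limit_speed x t y s k : 0 <= t -> cone X T y s -> 0 <= k ->
  Rabs (x - X) + t + 2 * k < T ->
  Rabs (y - x) + lam * Rabs (s - t) <= (lam - 1) * k ->
  Phi y s <= Phi x t + k * F M T /\ Psi y s <= Psi x t + k * F M T.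
Proof.
  intros Ht Hy Hk Hc Hd.
  assert (Hx : cone X T x t) by (split; lra).
  assert (S1 : forall n, phi (S n) y s <= phi (S n) x t + k * F M T).
  { intros n; apply (step_speed F (g1 + g2) lam HF Hlam) with X T; auto using dir_1.
    - now apply picard_admissible.
    - apply (picard_invariant X T HD (S n)).
    - apply source_picard_le.
    - split; [lra|abs_lra]. }
  assert (S2 : forall n, psi (S n) y s <= psi (S n) x t + k * F M T).
  { intros n; apply (step_speed F (g1 + g2) lam HF Hlam) with X T; auto using dir_m1.
    - now apply picard_admissible.
    - apply (picard_invariant X T HD (S n)).
    - apply source_picard_le.
    - split; [lra|abs_lra]. }
  split.
  - apply Phi_lub; [exact Hy|]; intros n.
    destruct (picard_increasing X T HD n y s Hy) as [H _].
    specialize (S1 n); pose proof (Phi_ub (S n) x t Hx); lra.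
  - apply Psi_lub; [exact Hy|]; intros n.
    destruct (picard_increasing X T HD n y s Hy) as [_ H].
    specialize (S2 n); pose proof (Psi_ub (S n) x t Hx); lra.
Qed.

(** Unlike for the iterates, the constant is uniform; [r] measures the room left below the lateral
    boundary. The estimate of difference quotients relies on this uniformity. *)
Lemma limit_lipschitz x t y s r : cone X T x t -> cone X T y s ->
  Rabs (y - x) + Rabs (s - t) <= r ->
  Rabs (x - X) + t + 2 * (lam / (lam - 1)) * r < T ->
  Rabs (y - X) + s + 2 * (lam / (lam - 1)) * r < T ->
  Rabs (Phi y s - Phi x t) <= lam / (lam - 1) * F M T * (Rabs (y - x) + Rabs (s - t)) /\
  Rabs (Psi y s - Psi x t) <= lam / (lam - 1) * F M T * (Rabs (y - x) + Rabs (s - t)).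
Proof.
  intros Hx Hy Hr Hrx Hry.
  set (d := Rabs (y - x) + Rabs (s - t)) in *.
  pose proof (Rabs_pos (y - x)); pose proof (Rabs_pos (s - t)).
  assert (HL : 0 < lam / (lam - 1)) by (apply Rdiv_lt_0_compat; lra).
  set (k := lam / (lam - 1) * d).
  assert (Ek : (lam - 1) * k = lam * d) by (unfold k; field; lra).
  assert (Hd : 0 <= d) by (unfold d; lra).
  assert (Hk : 0 <= k) by (unfold k; apply Rmult_le_pos; lra).
  assert (Hkr : k <= lam / (lam - 1) * r) by (unfold k; apply Rmult_le_compat_l; lra).
  assert (Hsp : Rabs (y - x) + lam * Rabs (s - t) <= (lam - 1) * k) by (rewrite Ek; unfold d; nra).
  destruct (Hx) as [Ht _]; destruct (Hy) as [Hs _].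
  destruct (limit_speed x t y s k) as [A1 A2]; auto; [lra|].
  destruct (limit_speed y s x t k) as [B1 B2]; auto; [lra| |].
  { rewrite (Rabs_minus_sym x), (Rabs_minus_sym t); exact Hsp. }
  replace (lam / (lam - 1) * F M T * d) with (k * F M T) by (unfold k; ring).
  split; apply Rabs_le; lra.
Qed.

Lemma limit_admissible : admissible (g1 + g2) lam X T U.
Proof.
  assert (HL : 0 < lam / (lam - 1)) by (apply Rdiv_lt_0_compat; lra).
  split.
  - exact limit_sum_ge.
  - destruct limit_cone_mono as [H1 H2]; intros x t y s Hx Hy Hxy.
    apply Rplus_le_compat; [now apply H1|now apply H2].
  - intros x t Hx; destruct (Hx) as [Ht Hx'].
    set (r := (T - Rabs (x - X) - t) / (4 * (1 + lam / (lam - 1)))).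
    assert (Hr : r * (4 * (1 + lam / (lam - 1))) = T - Rabs (x - X) - t).
    { unfold r; field; split; lra. }
    assert (Hr0 : 0 < r) by nra.
    exists (r / 2), (2 * (lam / (lam - 1) * F M T)); split; [lra|]; split.
    { pose proof (source_at_bound_pos x t Hx).
      apply Rmult_le_pos; [lra|]; apply Rmult_le_pos; lra. }
    intros y s Hy D1 D2.
    destruct (limit_lipschitz x t y s r) as [E1 E2]; auto; [lra|nra| |].
    { assert (Rabs (y - X) <= Rabs (y - x) + Rabs (x - X)).
      { replace (y - X) with (y - x + (x - X)) by ring; apply Rabs_triang. }
      pose proof (Rle_abs (s - t)). nra. }
    unfold U, total; simpl.
    replace (Phi y s + Psi y s - (Phi x t + Psi x t))
      with (Phi y s - Phi x t + (Psi y s - Psi x t)) by ring.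
    eapply Rle_trans; [apply Rabs_triang|]; lra.
Qed.

(** Since [F] increases, a negative difference [b - a] contributes nothing positive; one-sided
    bounds can then be iterated. *)
Lemma source_diff_le K L a b s : (forall a b s s', g1 + g2 <= a <= K -> g1 + g2 <= b <= K ->
    0 <= s -> 0 <= s' -> Rabs (F b s' - F a s) <= L * (Rabs (b - a) + Rabs (s' - s))) ->
  0 < L -> g1 + g2 <= a <= K -> g1 + g2 <= b <= K -> 0 <= s ->
  F b s - F a s <= L * Rmax 0 (b - a).
Proof.
  intros H HL Ha Hb Hs; destruct (Rle_dec a b) as [Hab|Hab].
  - rewrite Rmax_right by lra.
    specialize (H a b s s Ha Hb Hs Hs).
    rewrite Rminus_diag, Rabs_R0, Rplus_0_r, (Rabs_pos_eq (b - a)) in H by lra.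
    pose proof (Rle_abs (F b s - F a s)); lra.
  - rewrite Rmax_left by lra.
    pose proof (nl_mono _ _ HF b a s s ltac:(lra) ltac:(lra)); lra.
Qed.

(* Subsolutions of the integral equation lie below the limit of the iterates: the defect
   [w - u_n] contracts by a factor 1/2 in a weighted norm. *)
Lemma picard_comparison w K : M <= K ->
  (forall x t, cone X T x t -> g1 + g2 <= w x t <= K) ->
  (forall e x t, dir e -> cone X T x t -> ex_RInt (fun s => F (w (x + e * (t - s)) s) s) 0 t) ->
  (forall x t, cone X T x t -> w x t <= step F 1 f w x t + step F (-1) g w x t) ->
  exists kappa, 0 < kappa /\ forall n x t, cone X T x t ->
    w x t - u n x t <= (K - (g1 + g2)) * (1 / 2) ^ n * exp (kappa * t).
Proof.
  intros HMK Hw Hint Hsub.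
  destruct (nl_lip _ _ HF K) as [L [HL HLip]].
  (* Each of the two integrals contributes [L / (4 L) = 1/4] of the previous bound, together 1/2. *)
  exists (4 * L); split; [lra|].
  induction n as [|n IH]; intros x t Hc.
  - pose proof (Hw x t Hc).
    assert (1 <= exp (4 * L * t)) by (destruct Hc; apply exp_ge_1, Rmult_le_pos; lra).
    unfold u, total; simpl; nra.
  - destruct (Hc) as [Ht _].
    set (A := (K - (g1 + g2)) * (1 / 2) ^ n) in *.
    assert (HA : 0 <= A).
    { pose proof (Hw x t Hc); unfold A; apply Rmult_le_pos; [lra|]; apply pow_le; lra. }
    assert (Hu := picard_admissible X T HD n).
    assert (S : forall e h, dir e ->
      step F e h w x t - step F e h (u n) x t <= A / 4 * exp (4 * L * t)).
    { intros e h He; unfold step.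
      match goal with |- ?a + RInt ?p 0 t - (_ + RInt ?q 0 t) <= _ =>
        replace (a + RInt p 0 t - (a + RInt q 0 t)) with (RInt p 0 t - RInt q 0 t) by ring end.
      assert (I1 := Hint e x t He Hc).
      assert (I2 := source_on_char_ex_RInt F (g1 + g2) lam HF X T (u n) x t e 0 t
                      Hu He Hc (Rle_refl _) Ht (Rle_refl _)).
      rewrite RInt_sub by assumption.
      replace (A / 4 * exp (4 * L * t)) with ((L * A) / (4 * L) * exp (4 * L * t) + t * 0) by (field; lra).
      apply RInt_le_exp; try lra; [nra|now apply ex_RInt_sub_fun|].
      intros s Hs.
      assert (C : cone X T (x + e * (t - s)) s) by (apply cone_char; auto; lra).
      apply Rle_trans with (L * Rmax 0 (w (x + e * (t - s)) s - u n (x + e * (t - s)) s)).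
      - apply source_diff_le with K; auto; [|lra].
        split; [now apply (adm_ge _ _ _ _ _ Hu)|]; specialize (HM n _ _ C); lra.
      - rewrite Rplus_0_r, Rmult_assoc; apply Rmult_le_compat_l; [lra|].
        apply Rmax_lub; [apply Rmult_le_pos; [lra|apply Rlt_le, exp_pos]|now apply IH]. }
    pose proof (S 1 f dir_1) as S1; pose proof (S (-1) g dir_m1) as S2.
    specialize (Hsub x t Hc).
    replace ((K - (g1 + g2)) * (1 / 2) ^ Datatypes.S n) with (A / 2) by (unfold A; simpl; field).
    change (u (Datatypes.S n) x t) with (step F 1 f (u n) x t + step F (-1) g (u n) x t).
    lra.
Qed.

(** Each iterate is at most its successor, which is [step] of some [u n <= U]. *)
Lemma limit_subsolution x t : cone X T x t ->
  Phi x t <= step F 1 f U x t /\ Psi x t <= step F (-1) g U x t.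
Proof.
  intros Hc.
  assert (S : forall n e h, dir e -> step F e h (u n) x t <= step F e h U x t).
  { intros n e h He; apply step_le with X T; auto.
    - now apply picard_admissible.
    - apply limit_admissible.
    - intros; now apply picard_le_limit. }
  split; [apply Phi_lub|apply Psi_lub]; auto; intros n;
    destruct (picard_increasing X T HD n x t Hc) as [H1 H2].
  - apply Rle_trans with (1 := H1); exact (S n 1 f dir_1).
  - apply Rle_trans with (1 := H2); exact (S n (-1) g dir_m1).
Qed.

(** For the missing inequality no convergence theorem for integrals is called upon:
    [picard_comparison] applied to [U] itself gives [U - u n = O(2^(-n))] uniformly on the cone, so
    [step] of [U] exceeds the next iterate by [O(2^(-n))]. *)
Lemma limit_integral_equation x t : cone X T x t ->
  Phi x t = step F 1 f U x t /\ Psi x t = step F (-1) g U x t.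
Proof.
  intros Hc; destruct (limit_subsolution x t Hc) as [H1 H2].
  destruct (picard_comparison U M (Rle_refl _)) as [kappa [Hk Hcmp]].
  - intros y s Hy; split; [now apply limit_sum_ge|now apply limit_sum_le].
  - intros e y s He Hy; destruct (Hy).
    apply (source_on_char_ex_RInt F (g1 + g2) lam HF) with X T; auto; try lra.
    apply limit_admissible.
  - intros y s Hy; destruct (limit_subsolution y s Hy); now apply Rplus_le_compat.
  - destruct (nl_lip _ _ HF M) as [L [HL HLip]].
    destruct (Hc) as [Ht _].
    assert (S : forall n e h, dir e -> step F e h U x t
      <= step F e h (u n) x t + t * (L * ((M - (g1 + g2)) * exp (kappa * t))) * (1 / 2) ^ n).
    { intros n e h He; unfold step.
      assert (I1 := source_on_char_ex_RInt F (g1 + g2) lam HF X T U x t e 0 t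
                      limit_admissible He Hc (Rle_refl _) Ht (Rle_refl _)).
      assert (I2 := source_on_char_ex_RInt F (g1 + g2) lam HF X T (u n) x t e 0 t
                      (picard_admissible X T HD n) He Hc (Rle_refl _) Ht (Rle_refl _)).
      match goal with |- _ + ?p <= _ + ?q + ?r => cut (p - q <= r); [lra|] end.
      rewrite RInt_sub by assumption.
      set (c := L * ((M - (g1 + g2)) * exp (kappa * t)) * (1 / 2) ^ n).
      match goal with |- _ <= ?r => replace r with ((t - 0) * c) by (unfold c; ring) end.
      apply RInt_le_const; [lra|now apply ex_RInt_sub_fun|].
      intros s Hs.
      assert (C : cone X T (x + e * (t - s)) s) by (apply cone_char; auto; lra).
      pose proof (limit_sum_ge _ _ C); pose proof (limit_sum_le _ _ C).
      pose proof (picard_le_limit n _ _ C).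
      pose proof (adm_ge _ _ _ _ _ (picard_admissible X T HD n) _ _ C).
      apply Rle_trans with (L * Rmax 0 (U (x + e * (t - s)) s - u n (x + e * (t - s)) s)).
      - apply source_diff_le with M; auto; try lra.
      - rewrite Rmax_right by lra; unfold c; rewrite Rmult_assoc.
        apply Rmult_le_compat_l; [lra|].
        apply Rle_trans with (1 := Hcmp n _ _ C).
        replace ((M - (g1 + g2)) * exp (kappa * t) * (1 / 2) ^ n)
          with ((M - (g1 + g2)) * (1 / 2) ^ n * exp (kappa * t)) by ring.
        apply Rmult_le_compat_l.
        + apply Rmult_le_pos; [lra|apply pow_le; lra].
        + apply Rlt_le, exp_increasing, Rmult_lt_compat_l; lra. }
    split; apply Rle_antisym; auto.
    + apply le_of_geometric with (t * (L * ((M - (g1 + g2)) * exp (kappa * t)))); intros n.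
      apply Rle_trans with (1 := S n 1 f dir_1), Rplus_le_compat_r, (Phi_ub (Datatypes.S n) x t Hc).
    + apply le_of_geometric with (t * (L * ((M - (g1 + g2)) * exp (kappa * t)))); intros n.
      apply Rle_trans with (1 := S n (-1) g dir_m1), Rplus_le_compat_r, (Psi_ub (Datatypes.S n) x t Hc).
Qed.

(** * Time derivatives of the limit *)

Definition taylor_1 (h : R -> R) : Prop := exists hd K, 0 <= K /\ forall z z',
  Rabs (z - X) < T -> Rabs (z' - X) < T -> Rabs (h z' - h z - hd z * (z' - z)) <= K * (z' - z) ^ 2.

(** Equals [k k'] times the difference of the quotients for the steps [k] and [k']; it vanishes when
    [w] is affine in time. *)
Let defect (w : R -> R -> R) x t k k' := k' * (w x (t + k) - w x t) - k * (w x (t + k') - w x t).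

(* The defect of the time difference quotients solves, up to [O(k k' (k + k'))], the linearised
   integral equation, hence inherits the size of the error term. *)
Lemma limit_defect T2 : 0 < T2 < T -> taylor_1 f -> taylor_1 g ->
  exists eta C, 0 < eta /\ 0 <= C /\ forall x t k k', cone X T2 x t ->
    0 < k <= eta -> 0 < k' <= eta ->
    Rabs (defect Phi x t k k') <= C * (k * k' * (k + k')) /\
    Rabs (defect Psi x t k k') <= C * (k * k' * (k + k')).
Proof.
  intros HT2 [fd [Kf [HKf Hf]]] [gd [Kg [HKg Hg]]].
  assert (HL0 : 0 < lam / (lam - 1)) by (apply Rdiv_lt_0_compat; lra).
  assert (CX : cone X T X 0) by (split; [lra|rewrite Rminus_diag, Rabs_R0; lra]).
  assert (HB := source_at_bound_pos X 0 CX).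
  set (Lam := lam / (lam - 1) * F M T).
  assert (HLam : 0 <= Lam) by (unfold Lam; apply Rmult_le_pos; lra).
  (* Room for time steps up to [eta] above the cone of height [T2], plus the margin required by
     [limit_lipschitz] on the cone of height [T2 + eta]. *)
  set (eta := (T - T2) / (2 * (1 + 2 * (lam / (lam - 1))))).
  assert (Heta2 : eta * (1 + 2 * (lam / (lam - 1))) = (T - T2) / 2) by (unfold eta; field; split; lra).
  assert (Heta : 0 < eta) by nra.
  assert (HT3 : T2 + eta < T) by nra.
  clearbody eta.
  destruct (nl_taylor _ _ HF M (2 * Lam)) as [L [C1 [HL [HC1 HTay]]]]; [lra|].
  destruct (nl_lip _ _ HF M) as [K [HK HLip]].
  assert (HLU : forall x t y s, cone X (T2 + eta) x t -> cone X (T2 + eta) y s ->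
    Rabs (y - x) + Rabs (s - t) <= eta ->
    Rabs (Phi y s - Phi x t) <= Lam * (Rabs (y - x) + Rabs (s - t)) /\
    Rabs (Psi y s - Psi x t) <= Lam * (Rabs (y - x) + Rabs (s - t)) /\
    Rabs (U y s - U x t) <= 2 * Lam * (Rabs (y - x) + Rabs (s - t))).
  { intros x t y s Hx Hy Hd.
    destruct (limit_lipschitz x t y s eta) as [E1 E2]; auto;
      try (apply cone_le with (T2 + eta); auto; lra).
    - destruct Hx; nra.
    - destruct Hy; nra.
    - fold Lam in E1, E2; repeat split; auto.
      unfold U, total; simpl.
      replace (Phi y s + Psi y s - (Phi x t + Psi x t))
        with (Phi y s - Phi x t + (Psi y s - Psi x t)) by ring.
      eapply Rle_trans; [apply Rabs_triang|]; lra. }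
  assert (HU : forall x t, cone X (T2 + eta) x t -> g1 + g2 <= U x t <= M).
  { intros x t Hc; apply (cone_le X T) in Hc; [|lra].
    split; [now apply limit_sum_ge|now apply limit_sum_le]. }
  assert (Hup : forall x t k, cone X T2 x t -> 0 <= k <= eta -> cone X (T2 + eta) x (t + k)).
  { intros x t k [H1 H2] Hk; split; lra. }
  set (K1 := K * (2 * Lam + 1)).
  assert (HK1 : 0 <= K1) by (unfold K1; apply Rmult_le_pos; lra).
  (* Sum of the sources of error: the expansions of the data, the integral over the initial layer,
     and the Taylor remainder of [F] integrated over a time at most [T2]. *)
  set (D := Kf + Kg + K1 + T2 * C1).
  assert (HD0 : 0 <= D).
  { assert (0 <= T2 * C1) by (apply Rmult_le_pos; lra). unfold D; lra. }
  set (kappa := 4 * L).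
  exists eta, (2 * D * exp (kappa * T2)); split; [exact Heta|]; split.
  { repeat apply Rmult_le_pos; try lra; apply Rlt_le, exp_pos. }
  intros x0 t0 k k' Hc0 Hk Hk'.
  set (q := k * k' * (k + k')).
  assert (Hq : 0 <= q) by (unfold q; repeat apply Rmult_le_pos; lra).
  set (P := fun b => forall x t, cone X T2 x t -> Rabs (defect U x t k k') <= b * exp (kappa * t)).
  (* A time increment of one component splits into that of the datum, the layer integral [J] and the
     change [N] of the shifted source. Only [N] involves the defect of [U] again, with the factor
     [L / kappa = 1/4]. *)
  assert (Main : forall e h hd Kh chi b, dir e -> 0 <= b -> P b -> 0 <= Kh -> Kh <= Kf + Kg ->
    (forall z z', Rabs (z - X) < T -> Rabs (z' - X) < T ->
      Rabs (h z' - h z - hd z * (z' - z)) <= Kh * (z' - z) ^ 2) ->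
    (forall x t, cone X T x t -> chi x t = step F e h U x t) ->
    forall x t, cone X T2 x t -> Rabs (defect chi x t k k') <= D * q + b / 4 * exp (kappa * t)).
  { intros e h hd Kh chi b He Hb HP HKh HKh' Hh Hchi x t Hc.
    destruct (Hc) as [Ht Hx].
    assert (HA := limit_admissible).
    set (z := x + e * t).
    assert (Hz : Rabs (z - X) < T2) by (unfold z; destruct He as [->| ->]; abs_lra).
    set (J := fun k => RInt (fun s => F (U (z + e * (k - s)) s) s) 0 k).
    set (G := fun k s => F (U (x + e * (t - s)) (s + k)) (s + k)).
    set (N := fun k => RInt (G k) 0 t - RInt (G 0) 0 t).
    assert (Hc3 : forall k, 0 <= k <= eta -> cone X T x (t + k)).
    { intros j Hj; apply cone_le with (T2 + eta); [lra|]; now apply Hup. }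
    assert (Hex : forall k, 0 <= k <= eta -> ex_RInt (G k) 0 t).
    { intros j Hj; apply (ex_RInt_source_shifted F (g1 + g2) lam HF) with X T; auto; lra. }
    assert (Hdec : forall k, 0 < k <= eta -> chi x (t + k) - chi x t = h (z + e * k) - h z + J k + N k).
    { intros j Hj.
      pose proof (step_shift F (g1 + g2) lam HF X T U e h x t j HA He Ht ltac:(lra) (Hc3 j ltac:(lra))) as E.
      rewrite !Hchi, E by (try apply Hc3; try (apply cone_le with T2); auto; lra).
      fold z; unfold step, N, J, G.
      replace (RInt (fun s => F (U (x + e * (t - s)) (s + 0)) (s + 0)) 0 t)
        with (RInt (fun s => F (U (x + e * (t - s)) s) s) 0 t).
      - unfold z; ring.
      - apply RInt_ext; intros s _; now rewrite Rplus_0_r. }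
    unfold defect; rewrite (Hdec k Hk), (Hdec k' Hk').
    assert (B1 : forall j, 0 < j <= eta ->
      Rabs (h (z + e * j) - h z - hd z * e * j) <= Kh * j ^ 2).
    { intros j Hj.
      specialize (Hh z (z + e * j) ltac:(lra)).
      replace (z + e * j - z) with (e * j) in Hh by ring.
      replace ((e * j) ^ 2) with (j ^ 2) in Hh by (destruct He as [->| ->]; ring).
      rewrite Rmult_assoc; apply Hh; destruct He as [->| ->]; abs_lra. }
    assert (B2 : forall j, 0 < j <= eta -> Rabs (J j - F (U z 0) 0 * j) <= K1 * j ^ 2).
    { intros j Hj.
      assert (Cz : cone X (T2 + eta) z j) by (split; lra).
      assert (Cz0 : cone X (T2 + eta) z 0) by (split; lra).
      assert (EJ : ex_RInt (fun s => F (U (z + e * (j - s)) s) s) 0 j).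
      { apply (source_on_char_ex_RInt F (g1 + g2) lam HF) with X T; auto; try lra.
        apply cone_le with (T2 + eta); auto; lra. }
      assert (Hpt : forall s, 0 < s < j ->
        Rabs (F (U (z + e * (j - s)) s) s - F (U z 0) 0) <= K1 * j).
      { intros s Hs.
        assert (Cs : cone X (T2 + eta) (z + e * (j - s)) s) by (apply cone_char; auto; lra).
        assert (Hdist : Rabs (z + e * (j - s) - z) = j - s).
        { replace (z + e * (j - s) - z) with (e * (j - s)) by ring.
          rewrite dir_abs, Rabs_pos_eq; auto; lra. }
        assert (Hs0 : Rabs (s - 0) = s) by (rewrite Rminus_0_r, Rabs_pos_eq; lra).
        destruct (HLU z 0 _ _ Cz0 Cs) as [_ [_ HLu]]; [rewrite Hdist, Hs0; lra|].
        rewrite Hdist, Hs0 in HLu.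
        pose proof (HU _ _ Cs); pose proof (HU _ _ Cz0).
        eapply Rle_trans; [apply HLip; auto; lra|].
        rewrite Hs0; unfold K1; rewrite Rmult_assoc; apply Rmult_le_compat_l; lra. }
      assert (J j <= (j - 0) * (F (U z 0) 0 + K1 * j)).
      { unfold J; apply RInt_le_const; [lra|exact EJ|]; intros s Hs.
        apply (Rabs_diff_le _ _ _ (Hpt s Hs)). }
      assert ((j - 0) * (F (U z 0) 0 - K1 * j) <= J j).
      { unfold J; apply RInt_ge_const; [lra|exact EJ|]; intros s Hs.
        apply (Rabs_diff_le _ _ _ (Hpt s Hs)). }
      apply Rabs_le; simpl; lra. }
    assert (B3 : Rabs (k' * N k - k * N k') <= b / 4 * exp (kappa * t) + t * (C1 * q)).
    { unfold N.
      assert (E0 := Hex 0 ltac:(lra)); assert (E1 := Hex k ltac:(lra)); assert (E2 := Hex k' ltac:(lra)).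
      rewrite !RInt_sub by assumption.
      rewrite <- !RInt_mult_l by now apply ex_RInt_sub_fun.
      rewrite RInt_sub by (apply ex_RInt_mult_l; now apply ex_RInt_sub_fun).
      replace (b / 4) with ((L * b) / kappa) by (unfold kappa; field; lra).
      apply RInt_abs_le_exp; [lra|unfold kappa; lra|nra| |].
      { apply ex_RInt_sub_fun; apply ex_RInt_mult_l; now apply ex_RInt_sub_fun. }
      intros s Hs; unfold G; rewrite Rplus_0_r.
      assert (Cs : cone X T2 (x + e * (t - s)) s) by (apply cone_char; auto; lra).
      set (y := x + e * (t - s)) in *.
      assert (Cs3 : cone X (T2 + eta) y s) by (apply cone_le with T2; auto; lra).
      destruct (HTay (U y s) s (HU _ _ Cs3) ltac:(lra)) as [A [B [HAL HAB]]].
      assert (Hj : forall j, 0 < j <= eta ->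
        Rabs (F (U y (s + j)) (s + j) - F (U y s) s - A * (U y (s + j) - U y s) - B * j) <= C1 * j ^ 2).
      { intros j Hj; assert (Csj := Hup _ _ j Cs ltac:(lra)).
        apply HAB; [now apply HU|lra|].
        destruct (HLU _ _ _ _ Cs3 Csj) as [_ [_ HLu]];
          replace (s + j - s) with j in * by ring; rewrite Rminus_diag, Rabs_R0 in *;
          rewrite (Rabs_pos_eq j) in * by lra; [lra|].
        now rewrite Rplus_0_l in HLu. }
      pose proof (cross_defect_le _ _ B C1 k k' ltac:(lra) ltac:(lra) (Hj k Hk) (Hj k' Hk')) as Hcd.
      fold q in Hcd.
      specialize (HP y s Cs); unfold defect in HP.
      set (E := k' * (U y (s + k) - U y s) - k * (U y (s + k') - U y s)) in *.
      match type of Hcd with Rabs ?r <= _ =>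
        match goal with |- Rabs ?l <= _ => replace l with (A * E + r) by (unfold E; ring) end end.
      eapply Rle_trans; [apply Rabs_triang|].
      apply Rplus_le_compat; [|exact Hcd].
      rewrite Rabs_mult, Rmult_assoc; apply Rmult_le_compat; auto using Rabs_pos. }
    pose proof (cross_defect_le _ _ _ _ k k' ltac:(lra) ltac:(lra) (B1 k Hk) (B1 k' Hk')) as D1.
    pose proof (cross_defect_le _ _ _ _ k k' ltac:(lra) ltac:(lra) (B2 k Hk) (B2 k' Hk')) as D2.
    fold q in D1, D2.
    match type of D1 with Rabs ?a <= _ => match type of D2 with Rabs ?b <= _ =>
      match type of B3 with Rabs ?c <= _ =>
        match goal with |- Rabs ?l <= _ => replace l with (a + b + c) by ring end end end end.
    eapply Rle_trans; [apply Rabs_triang|].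
    eapply Rle_trans; [apply Rplus_le_compat_r, Rabs_triang|].
    assert (Kh * q <= (Kf + Kg) * q) by (apply Rmult_le_compat_r; lra).
    assert (t * (C1 * q) <= T2 * (C1 * q)).
    { apply Rmult_le_compat_r; [apply Rmult_le_pos; lra|]; pose proof (Rabs_pos (x - X)); lra. }
    unfold D; lra. }
  assert (HPhi := fun x t Hc => proj1 (limit_integral_equation x t Hc)).
  assert (HPsi := fun x t Hc => proj2 (limit_integral_equation x t Hc)).
  assert (MPhi := fun b Hb HP => Main 1 f fd Kf Phi b dir_1 Hb HP HKf ltac:(lra) Hf HPhi).
  assert (MPsi := fun b Hb HP => Main (-1) g gd Kg Psi b dir_m1 Hb HP HKg ltac:(lra) Hg HPsi).
  (* The Lipschitz bound starts the iteration with a term of order [k k'] only. Adding both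
     components sends [b] to at most [4 (D q) / 2 + b / 2], whose fixed point is [4 (D q)], and the
     initial excess [b0] decays geometrically. *)
  set (b0 := 4 * Lam * (k * k')).
  assert (Hkk : 0 < k * k') by (apply Rmult_lt_0_compat; lra).
  assert (Hb0 : 0 <= b0) by (unfold b0; apply Rmult_le_pos; lra).
  assert (Pn : forall n, P (4 * (D * q) + b0 * (1 / 2) ^ n)).
  { assert (HDq : 0 <= D * q) by now apply Rmult_le_pos.
    induction n as [|n IH]; intros x t Hc.
    - assert (Hj : forall j, 0 < j <= eta -> Rabs (U x (t + j) - U x t) <= 2 * Lam * j).
      { intros j Hj; assert (Cj := Hup _ _ j Hc ltac:(lra)).
        assert (C0 : cone X (T2 + eta) x t) by (apply cone_le with T2; auto; lra).
        destruct (HLU _ _ _ _ C0 Cj) as [_ [_ HLu]];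
          replace (t + j - t) with j in * by ring; rewrite Rminus_diag, Rabs_R0 in *;
          rewrite (Rabs_pos_eq j) in * by lra; [lra|].
        now rewrite Rplus_0_l in HLu. }
      assert (E1 := Hj k Hk); assert (E2 := Hj k' Hk').
      apply Rmult_le_compat_l with (r := k') in E1; [|lra].
      apply Rmult_le_compat_l with (r := k) in E2; [|lra].
      assert (1 <= exp (kappa * t)).
      { destruct Hc; apply exp_ge_1, Rmult_le_pos; unfold kappa; lra. }
      apply Rle_trans with b0; [|simpl; nra].
      unfold defect, Rminus at 1; eapply Rle_trans; [apply Rabs_triang|].
      rewrite Rabs_Ropp, !Rabs_mult, (Rabs_pos_eq k), (Rabs_pos_eq k') by lra.
      unfold b0; lra.
    - assert (Hpow : 0 <= (1 / 2) ^ n) by (apply pow_le; lra).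
      assert (Hb : 0 <= 4 * (D * q) + b0 * (1 / 2) ^ n) by nra.
      assert (1 <= exp (kappa * t)).
      { destruct Hc; apply exp_ge_1, Rmult_le_pos; unfold kappa; lra. }
      assert (E1 := MPhi _ Hb IH x t Hc); assert (E2 := MPsi _ Hb IH x t Hc).
      assert (ES : defect U x t k k' = defect Phi x t k k' + defect Psi x t k k')
        by (unfold defect, U, total; simpl; ring).
      rewrite ES; eapply Rle_trans; [apply Rabs_triang|].
      replace ((1 / 2) ^ S n) with ((1 / 2) ^ n / 2) by (simpl; field).
      nra. }
  assert (PD : P (4 * (D * q))).
  { intros x t Hc; apply le_of_geometric with (b0 * exp (kappa * t)); intros n.
    apply Rle_trans with (1 := Pn n x t Hc); lra. }
  assert (HDq : 0 <= 4 * (D * q)) by (apply Rmult_le_pos; [lra|now apply Rmult_le_pos]).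
  assert (exp (kappa * t0) <= exp (kappa * T2)).
  { apply Rlt_le, exp_increasing, Rmult_lt_compat_l; [unfold kappa; lra|].
    destruct Hc0; pose proof (Rabs_pos (x0 - X)); lra. }
  assert (1 <= exp (kappa * T2)) by (apply exp_ge_1, Rmult_le_pos; unfold kappa; lra).
  assert (D * q * 1 <= D * q * exp (kappa * T2)) by (apply Rmult_le_compat_l; lra).
  assert (D * q * exp (kappa * t0) <= D * q * exp (kappa * T2)) by (apply Rmult_le_compat_l; lra).
  fold q; split.
  - apply Rle_trans with (1 := MPhi _ HDq PD x0 t0 Hc0); lra.
  - apply Rle_trans with (1 := MPsi _ HDq PD x0 t0 Hc0); lra.
Qed.

Lemma limit_ex_derive x t : taylor_1 f -> taylor_1 g -> cone X T x t -> 0 < t ->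
  ex_derive (Phi x) t /\ ex_derive (Psi x) t.
Proof.
  intros Hf Hg [_ Hx] Ht.
  set (T2 := (T + (Rabs (x - X) + t)) / 2).
  assert (Hxp := Rabs_pos (x - X)).
  destruct (limit_defect T2) as [eta [C [Heta [HC H]]]]; auto; [unfold T2; lra|].
  assert (Hcone : forall s, 0 <= s < T2 - Rabs (x - X) -> cone X T2 x s)
    by (intros s Hs; split; lra).
  split; apply ex_derive_uniform_quotients with (T2 - Rabs (x - X)) eta C; auto;
    try (unfold T2; lra); intros s k k' Hs Hk Hk'; apply (H x s k k' (Hcone s Hs) Hk Hk').
Qed.

(** With [j = lam (k - j)], the point [(x - e j, t + j)] of the characteristic precedes
    [(x, t + k)]. On the way to it [chi] gains at least [j F(U x t, t)], and
    [j / k = lam / (1 + lam)]. *)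
Lemma limit_derive_ge x t e h chi l : dir e ->
  (forall x t, cone X T x t -> chi x t = step F e h U x t) -> cone_mono lam X T chi ->
  cone X T x t -> 0 < t -> is_derive (chi x) t l -> lam / (1 + lam) * F (U x t) t <= l.
Proof.
  intros He Hchi Hmono Hc Ht Hl.
  destruct (Hc) as [_ Hx].
  apply is_derive_ge_right with (chi x) t ((T - (Rabs (x - X) + t)) / 2); [exact Hl|lra|].
  intros k Hk.
  set (j := lam / (1 + lam) * k).
  assert (Hj : j * (1 + lam) = lam * k) by (unfold j; field; lra).
  assert (Hj1 : 0 < j < k) by nra.
  assert (Cj : cone X T (x - e * j) (t + j)) by (split; [lra|destruct He as [->| ->]; abs_lra]).
  assert (Ck : cone X T x (t + k)) by (split; lra).
  assert (H1 : chi (x - e * j) (t + j) <= chi x (t + k)).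
  { apply Hmono; auto.
    replace (x - (x - e * j)) with (e * j) by ring.
    rewrite dir_abs, Rabs_pos_eq by (auto; lra); lra. }
  rewrite Hchi in H1 by assumption.
  rewrite (step_along_char F (g1 + g2) lam HF X T) in H1 by (auto using limit_admissible; lra).
  rewrite <- Hchi in H1 by assumption.
  assert (H2 : (t + j - t) * F (U x t) t <= RInt (fun s => F (U (x + e * (t - s)) s) s) t (t + j)).
  { assert (Hpt : forall s, t <= s <= t + j -> cone X T (x + e * (t - s)) s).
    { intros s Hs; replace (x + e * (t - s)) with (x - e * j + e * (t + j - s)) by ring.
      apply cone_char; auto; lra. }
    apply RInt_ge_const; [lra| |].
    - apply ex_RInt_ext with (fun s => F (U (x - e * j + e * (t + j - s)) s) s).
      + intros s _; do 2 f_equal; ring.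
      + apply (source_on_char_ex_RInt F (g1 + g2) lam HF) with X T; auto using limit_admissible; lra.
    - intros s Hs; apply (nl_mono _ _ HF); [|lra].
      split; [now apply limit_sum_ge|].
      apply (adm_mono _ _ _ _ _ limit_admissible); [exact Hc|apply Hpt; lra|].
      replace (x + e * (t - s) - x) with (e * (t - s)) by ring.
      rewrite dir_abs, Rabs_left by (auto; lra); nra. }
  replace ((t + j - t) * F (U x t) t) with (lam / (1 + lam) * F (U x t) t * k) in H2
    by (unfold j; ring).
  lra.
Qed.

(** Here [j = lam (j - k)], so [(x, t + k)] precedes [(x - e j, t + j)], and
    [j / k = lam / (lam - 1)]. The source on this piece of characteristic is bounded by its value at
    the later point [(x, t')]. *)
Lemma limit_derive_le_later x t t' e h chi l : dir e ->
  (forall x t, cone X T x t -> chi x t = step F e h U x t) -> cone_mono lam X T chi ->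
  t < t' -> cone X T x t' -> 0 < t -> is_derive (chi x) t l -> l <= lam / (lam - 1) * F (U x t') t'.
Proof.
  intros He Hchi Hmono Htt Hc' Ht Hl.
  destruct (Hc') as [_ Hx].
  assert (Hc : cone X T x t) by (split; lra).
  set (d := (lam - 1) / lam * (t' - t) / 2).
  assert (Hd : d * lam = (lam - 1) * (t' - t) / 2) by (unfold d; field; lra).
  apply is_derive_le_right with (chi x) t d; [exact Hl|nra|].
  intros k Hk.
  set (j := lam / (lam - 1) * k).
  assert (Hj : j * (lam - 1) = lam * k) by (unfold j; field; lra).
  assert (Hj1 : k < j) by nra.
  assert (Hj2 : 2 * j < t' - t).
  { apply Rmult_lt_reg_r with (lam - 1); [lra|]; nra. }
  assert (Cj : cone X T (x - e * j) (t + j)) by (split; [lra|destruct He as [->| ->]; abs_lra]).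
  assert (Ck : cone X T x (t + k)) by (split; lra).
  assert (H1 : chi x (t + k) <= chi (x - e * j) (t + j)).
  { apply Hmono; auto.
    replace (x - e * j - x) with (e * - j) by ring.
    rewrite dir_abs, Rabs_left by (auto; lra); lra. }
  rewrite (Hchi (x - e * j)) in H1 by assumption.
  rewrite (step_along_char F (g1 + g2) lam HF X T) in H1 by (auto using limit_admissible; lra).
  rewrite <- Hchi in H1 by assumption.
  assert (H2 : RInt (fun s => F (U (x + e * (t - s)) s) s) t (t + j) <= (t + j - t) * F (U x t') t').
  { assert (Hpt : forall s, t <= s <= t + j -> cone X T (x + e * (t - s)) s).
    { intros s Hs; replace (x + e * (t - s)) with (x - e * j + e * (t + j - s)) by ring.
      apply cone_char; auto; lra. }
    apply RInt_le_const; [lra| |].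
    - apply ex_RInt_ext with (fun s => F (U (x - e * j + e * (t + j - s)) s) s).
      + intros s _; do 2 f_equal; ring.
      + apply (source_on_char_ex_RInt F (g1 + g2) lam HF) with X T; auto using limit_admissible; lra.
    - intros s Hs; apply (nl_mono _ _ HF); [|lra].
      split; [apply limit_sum_ge, Hpt; lra|].
      apply (adm_mono _ _ _ _ _ limit_admissible); [apply Hpt; lra|exact Hc'|].
      replace (x - (x + e * (t - s))) with (e * (s - t)) by ring.
      rewrite dir_abs, Rabs_pos_eq by (auto; lra); nra. }
  replace ((t + j - t) * F (U x t') t') with (lam / (lam - 1) * F (U x t') t' * k) in H2
    by (unfold j; ring).
  lra.
Qed.

(** Lets [t'] decrease to [t] along [t + a] with [a] halved at each [n]; Lipschitz continuity of [U]
    and [F] makes the error [O(a)]. *)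
Lemma limit_derive_le x t e h chi l : dir e ->
  (forall x t, cone X T x t -> chi x t = step F e h U x t) -> cone_mono lam X T chi ->
  cone X T x t -> 0 < t -> is_derive (chi x) t l -> l <= lam / (lam - 1) * F (U x t) t.
Proof.
  intros He Hchi Hmono Hc Ht Hl.
  destruct (Hc) as [_ Hx].
  assert (HL0 : 0 < lam / (lam - 1)) by (apply Rdiv_lt_0_compat; lra).
  destruct (adm_lip _ _ _ _ _ limit_admissible x t Hc) as [d [L [Hd [HL HLip]]]].
  destruct (nl_lip _ _ HF M) as [K [HK HKL]].
  set (r := T - (Rabs (x - X) + t)).
  assert (Hr : 0 < r) by (unfold r; lra).
  apply le_of_geometric with (lam / (lam - 1) * (K * (L + 1) * (Rmin d r / 2))); intros n.
  assert (Hm0 : 0 < Rmin d r) by now apply Rmin_pos.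
  pose proof (Rmin_l d r); pose proof (Rmin_r d r).
  set (a := Rmin d r / 2 * (1 / 2) ^ n).
  assert (Hpow : 0 < (1 / 2) ^ n <= 1).
  { split; [apply pow_lt; lra|].
    pose proof (pow_incr (1 / 2) 1 n ltac:(lra)) as Hp; rewrite pow1 in Hp; exact Hp. }
  assert (Ha : 0 < a <= Rmin d r / 2) by (unfold a; split; [apply Rmult_lt_0_compat|]; nra).
  assert (Ca : cone X T x (t + a)) by (unfold r in *; split; lra).
  apply Rle_trans with (1 := limit_derive_le_later x t (t + a) e h chi l He Hchi Hmono ltac:(lra) Ca Ht Hl).
  assert (E : Rabs (x - x) = 0) by (rewrite Rminus_diag; apply Rabs_R0).
  assert (E' : Rabs (t + a - t) = a) by (replace (t + a - t) with a by ring; apply Rabs_pos_eq; lra).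
  specialize (HLip x (t + a) Ca ltac:(lra) ltac:(lra)); rewrite E, E' in HLip.
  specialize (HKL (U x t) (U x (t + a)) t (t + a)
    (conj (limit_sum_ge x t Hc) (limit_sum_le x t Hc))
    (conj (limit_sum_ge x _ Ca) (limit_sum_le x _ Ca)) ltac:(lra) ltac:(lra)).
  rewrite E' in HKL.
  assert (K * (Rabs (U x (t + a) - U x t) + a) <= K * (L + 1) * a).
  { rewrite Rmult_assoc; apply Rmult_le_compat_l; lra. }
  assert (F (U x (t + a)) (t + a) <= F (U x t) t + K * (L + 1) * a).
  { destruct (Rabs_diff_le _ _ _ HKL); lra. }
  replace (lam / (lam - 1) * F (U x t) t + lam / (lam - 1) * (K * (L + 1) * (Rmin d r / 2)) * (1 / 2) ^ n)
    with (lam / (lam - 1) * (F (U x t) t + K * (L + 1) * a)) by (unfold a; ring).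
  apply Rmult_le_compat_l; lra.
Qed.

Lemma limit_derive_bounds x t : taylor_1 f -> taylor_1 g -> cone X T x t -> 0 < t ->
  let lo := lam / (1 + lam) * F (U x t) t in
  let hi := lam / (lam - 1) * F (U x t) t in
  ex_derive (Phi x) t /\ ex_derive (Psi x) t /\
  lo <= Derive (Phi x) t <= hi /\ lo <= Derive (Psi x) t <= hi.
Proof.
  intros Hf Hg Hc Ht lo hi.
  destruct (limit_ex_derive x t Hf Hg Hc Ht) as [E1 E2].
  destruct limit_cone_mono as [M1 M2].
  assert (D1 := Derive_correct _ _ E1); assert (D2 := Derive_correct _ _ E2).
  assert (HPhi := fun x t Hc => proj1 (limit_integral_equation x t Hc)).
  assert (HPsi := fun x t Hc => proj2 (limit_integral_equation x t Hc)).
  repeat split; auto.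
  - now apply limit_derive_ge with 1 f Phi; auto using dir_1.
  - now apply limit_derive_le with 1 f Phi; auto using dir_1.
  - now apply limit_derive_ge with (-1) g Psi; auto using dir_m1.
  - now apply limit_derive_le with (-1) g Psi; auto using dir_m1.
Qed.

End Limit.
(** The data lie above [g1] and [g2], so [v], read as a function of [(x, t)] constant in [x], is a
    subsolution of the integral equation. Comparison gives [v - u n = O(2^(-n))], while
    [u n <= M]. *)
Lemma ode_subsolution_le X T M v : cauchy_data f g g1 g2 m X T ->
  (forall n x t, cone X T x t -> u n x t <= M) ->
  (forall s s', 0 <= s <= s' -> s' <= T -> v s <= v s') -> v 0 = g1 + g2 ->
  (forall t, 0 <= t <= T -> ex_RInt (fun s => F (v s) s) 0 t) ->
  (forall t, 0 <= t <= T -> v t <= g1 + g2 + 2 * RInt (fun s => F (v s) s) 0 t) ->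
  forall t, 0 <= t < T -> v t <= M.
Proof.
  intros HD HM Hmono Hv0 Hex Hsub t Ht.
  assert (Ct : cone X T X t) by (split; [lra|rewrite Rminus_diag, Rabs_R0; lra]).
  assert (Hrange : forall x t, cone X T x t -> 0 <= t <= T).
  { intros x s [H1 H2]; pose proof (Rabs_pos (x - X)); lra. }
  destruct (picard_comparison X T M HD HM (fun _ s => v s) (Rmax M (v T)) (Rmax_l _ _))
    as [kappa [Hk Hcmp]].
  - intros x s Hc; apply Hrange in Hc; split.
    + rewrite <- Hv0; apply Hmono; lra.
    + apply Rle_trans with (2 := Rmax_r _ _); apply Hmono; lra.
  - intros e x s He Hc; apply Hex; now apply Hrange in Hc.
  - intros x s Hc; unfold step.
    pose proof (data_f_ge _ _ _ _ _ _ _ HD (x + 1 * s)) as H1.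
    pose proof (data_g_ge _ _ _ _ _ _ _ HD (x + -1 * s)) as H2.
    destruct (Hc) as [Hs Hx].
    specialize (H1 ltac:(abs_lra)); specialize (H2 ltac:(abs_lra)).
    specialize (Hsub s (Hrange _ _ Hc)); lra.
  - apply le_of_geometric with ((Rmax M (v T) - (g1 + g2)) * exp (kappa * t)); intros n.
    specialize (Hcmp n X t Ct); specialize (HM n X t Ct); lra.
Qed.

(* Because [lam > 1], a bound on the segment below [(x, T)] controls, at the time [T - eta], a
   neighbourhood of the base of a light cone whose apex lies above [(x, T)]; on the remaining
   strip the iterates cannot grow by more than a factor 3. *)
Lemma picard_bounded_beyond Y R0 x T M d0 : 0 < g1 -> 0 < g2 -> cauchy_data f g g1 g2 m Y R0 ->
  0 < T -> 0 < d0 -> Rabs (x - Y) + T + d0 <= R0 ->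
  (forall n t, 0 <= t < T -> u n x t <= M) ->
  exists d, 0 < d < d0 /\ forall n, u n x (T + d) <= 3 * M.
Proof.
  intros Hg1 Hg2 HD0 HT Hd0 HR HM.
  assert (HMg : g1 + g2 <= M) by exact (HM 0%nat 0 ltac:(lra)).
  assert (HB0 : F (g1 + g2) 0 <= F (3 * M) (T + d0)) by (apply (nl_mono _ _ HF); lra).
  pose proof (nl_pos _ _ HF) as HF0.
  set (B := F (3 * M) (T + d0)) in *.
  (* The strip between [T - eta] and [T + d] has height at most [2 eta]; this choice limits the
     growth of each component across it to [2 eta B <= M / 2]. *)
  set (eta := Rmin (T / 2) (M / (4 * (B + 1)))).
  assert (Heta : 0 < eta) by (apply Rmin_pos; [lra|apply Rdiv_lt_0_compat; lra]).
  assert (He1 : eta <= T / 2) by apply Rmin_l.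
  assert (He2 : 4 * (eta * B) <= M).
  { assert (E : eta <= M / (4 * (B + 1))) by apply Rmin_r.
    apply Rmult_le_compat_r with (r := 4 * (B + 1)) in E; [|lra].
    replace (M / (4 * (B + 1)) * (4 * (B + 1))) with M in E by (field; lra). nra. }
  set (d := Rmin (Rmin ((lam - 1) * eta / 2) eta) d0).
  assert (Hle : 0 < (lam - 1) * eta) by (apply Rmult_lt_0_compat; lra).
  assert (Hd : 0 < d) by (apply Rmin_pos; [apply Rmin_pos; lra|lra]).
  assert (Hd1 : d <= (lam - 1) * eta / 2) by (eapply Rle_trans; [apply Rmin_l|apply Rmin_l]).
  assert (Hd2 : d <= eta) by (eapply Rle_trans; [apply Rmin_l|apply Rmin_r]).
  assert (Hd3 : d <= d0) by apply Rmin_r.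
  clearbody eta d.
  assert (HD : cauchy_data f g g1 g2 m x (T + d)) by (apply cauchy_data_sub with Y R0; auto; lra).
  assert (Low : forall n y s, cone x (T + d) y s -> s <= T - eta -> u n y s <= M).
  { intros n y s Hc Hs; destruct (Hc) as [Hs0 Hy].
    (* Solves [lam (T - t) = (lam - 1) eta - d]: the points of the cone up to the level [T - eta]
       all precede [(x, t)], and [d < (lam - 1) eta] gives [t < T]. *)
    set (t := T - ((lam - 1) * eta - d) / lam).
    assert (Et : lam * t = lam * T - ((lam - 1) * eta - d)) by (unfold t; field; lra).
    assert (Hys : Rabs (y - x) <= lam * (t - s)) by nra.
    assert (Hst : s <= t) by (pose proof (Rabs_pos (y - x)); nra).
    assert (HtT : t < T) by nra.
    apply Rle_trans with (u n x t); [|apply HM; lra].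
    apply (adm_mono _ _ _ _ _ (picard_admissible x (T + d) HD n)); [exact Hc| |].
    - split; [lra|rewrite Rminus_diag, Rabs_R0; lra].
    - now rewrite Rabs_minus_sym. }
  assert (All : forall n y s, cone x (T + d) y s -> u n y s <= 3 * M).
  { induction n as [|n IH]; intros y s Hc.
    - unfold u, total; simpl; lra.
    - destruct (Rle_dec s (T - eta)) as [Hs|Hs]; [specialize (Low (S n) y s Hc Hs); lra|].
      destruct (Hc) as [Hs0 Hy].
      assert (HA := picard_admissible x (T + d) HD n).
      set (t0 := T - eta) in *; set (k := s - t0).
      assert (Ht0 : 0 <= t0) by (unfold t0; lra).
      assert (Hk : 0 <= k <= 2 * eta) by (pose proof (Rabs_pos (y - x)); unfold k, t0 in *; lra).
      assert (St : forall e h, dir e ->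
        step F e h (u n) y s <= step F e h (u n) (y + e * k) t0 + M / 2).
      { intros e h He.
        assert (E : step F e h (u n) y s = step F e h (u n) (y + e * k - e * k) (t0 + k))
          by (f_equal; unfold k; ring).
        assert (Hc' : cone x (T + d) (y + e * k - e * k) (t0 + k)).
        { replace (y + e * k - e * k) with y by ring; replace (t0 + k) with s by (unfold k; ring).
          exact Hc. }
        rewrite E, (step_along_char F (g1 + g2) lam HF x (T + d)) by (auto; lra).
        apply Rplus_le_compat_l.
        apply Rle_trans with ((t0 + k - t0) * B); [|nra].
        apply RInt_le_const; [lra| |].
        - apply ex_RInt_ext with (fun r => F (u n (y + e * k - e * k + e * (t0 + k - r)) r) r).
          + intros r _; do 2 f_equal; ring.
          + apply (source_on_char_ex_RInt F (g1 + g2) lam HF) with x (T + d); auto; unfold t0; lra.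
        - intros r Hr.
          assert (Cr : cone x (T + d) (y + e * k + e * (t0 - r)) r).
          { replace (y + e * k + e * (t0 - r)) with (y + e * (s - r)) by (unfold k; ring).
            apply cone_char; auto; unfold k, t0 in *; lra. }
          apply (nl_mono _ _ HF).
          + split; [now apply (adm_ge _ _ _ _ _ HA)|now apply IH].
          + destruct Cr; pose proof (Rabs_pos (y + e * k + e * (t0 - r) - x)); lra. }
      (* The two characteristics meet the level [t0] at different points, so the components are
         bounded there separately, each by [M] because the other is positive. With the two growths
         [M / 2] the total is [3 M]. *)
      pose proof (St 1 f dir_1) as S1; pose proof (St (-1) g dir_m1) as S2.
      assert (C1 : cone x (T + d) (y + 1 * k) t0) by (apply cone_char; [apply dir_1|exact Hc|lra]).
      assert (C2 : cone x (T + d) (y + -1 * k) t0) by (apply cone_char; [apply dir_m1|exact Hc|lra]).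
      pose proof (Low (S n) _ _ C1 (Rle_refl _)) as L1.
      pose proof (Low (S n) _ _ C2 (Rle_refl _)) as L2.
      destruct (picard_invariant x (T + d) HD (S n)) as [I1 [I2 _]].
      pose proof (I2 _ _ C1) as J1; pose proof (I1 _ _ C2) as J2.
      change (u (S n)) with (fun a b => step F 1 f (u n) a b + step F (-1) g (u n) a b) in *.
      change (phi (S n)) with (step F 1 f (u n)) in *.
      change (psi (S n)) with (step F (-1) g (u n)) in *.
      cbv beta in *; lra. }
  (* The apex [(x, T + d)] itself is not in the cone. *)
  exists (d / 2); split; [lra|]; intros n.
  apply All; split; [lra|rewrite Rminus_diag, Rabs_R0; lra].
Qed.

End Picard.

(** * Blow-up rates *)

Lemma Rpower_le_neg a b r : r <= 0 -> 0 < a <= b -> Rpower b r <= Rpower a r.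
Proof.
  intros Hr Hab; replace r with (- - r) by ring; rewrite (Rpower_Ropp a), (Rpower_Ropp b).
  apply Rinv_le_contravar; [apply Rpower_pos|apply Rle_Rpower_l; lra].
Qed.

Lemma is_derive_Rpower_comp u t l r : 0 < u t -> is_derive u t l ->
  is_derive (fun s => Rpower (u s) r) t (r * Rpower (u t) (r - 1) * l).
Proof.
  intros Hu Hl.
  replace (r * Rpower (u t) (r - 1) * l) with (scal l (r * Rpower (u t) (r - 1)))
    by (unfold scal; simpl; unfold mult; simpl; ring).
  apply (@is_derive_comp R_AbsRing R_NormedModule (fun x => Rpower x r)); [|exact Hl].
  now apply is_derive_Reals, derivable_pt_lim_power.
Qed.

(* [u^(1-p)] is Lipschitz with slopes between [-B(p-1)] and [-A(p-1)], and vanishes at [T]. *)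
Lemma blowup_rate p A B T u du : 1 < p -> 0 < A ->
  (forall s, 0 < s < T -> 0 < u s /\ is_derive u s (du s) /\
     A * Rpower (u s) p <= du s <= B * Rpower (u s) p) ->
  (forall M t, 0 < t < T -> exists t', t < t' < T /\ M < u t') ->
  forall t, 0 < t < T ->
  A * (p - 1) * (T - t) <= Rpower (u t) (1 - p) <= B * (p - 1) * (T - t).
Proof.
  intros Hp HA Hu Hinf t Ht.
  assert (Hinc : forall t', t < t' < T ->
    A * (p - 1) * (t' - t) <= Rpower (u t) (1 - p) - Rpower (u t') (1 - p) <= B * (p - 1) * (t' - t)).
  { intros t' Ht'.
    assert (HD : forall s, t <= s <= t' -> is_derive (fun s => Rpower (u s) (1 - p)) s
                   ((1 - p) * Rpower (u s) (1 - p - 1) * du s)).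
    { intros s Hs; destruct (Hu s ltac:(lra)) as [H1 [H2 _]]; now apply is_derive_Rpower_comp. }
    destruct (MVT_gen (fun s => Rpower (u s) (1 - p)) t t'
      (fun s => (1 - p) * Rpower (u s) (1 - p - 1) * du s)) as [c [Hc E]].
    - rewrite Rmin_left, Rmax_right by lra; intros s Hs; apply HD; lra.
    - rewrite Rmin_left, Rmax_right by lra; intros s Hs; apply derivable_continuous_pt.
      exists ((1 - p) * Rpower (u s) (1 - p - 1) * du s); now apply is_derive_Reals, HD.
    - rewrite Rmin_left, Rmax_right in Hc by lra.
      destruct (Hu c ltac:(lra)) as [H1 [_ H3]].
      assert (Einv : Rpower (u c) (1 - p - 1) * Rpower (u c) p = 1).
      { rewrite <- Rpower_plus; replace (1 - p - 1 + p) with 0 by ring; now apply Rpower_O. }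
      set (y := Rpower (u c) (1 - p - 1)) in *.
      assert (Hy : 0 < y) by apply Rpower_pos.
      assert (Hyd : A <= y * du c <= B).
      { destruct H3 as [H3 H4].
        apply Rmult_le_compat_l with (r := y) in H3; [|lra].
        apply Rmult_le_compat_l with (r := y) in H4; [|lra].
        replace (y * (A * Rpower (u c) p)) with (A * (y * Rpower (u c) p)) in H3 by ring.
        replace (y * (B * Rpower (u c) p)) with (B * (y * Rpower (u c) p)) in H4 by ring.
        rewrite Einv in H3, H4; lra. }
      replace (Rpower (u t) (1 - p) - Rpower (u t') (1 - p))
        with (y * du c * ((p - 1) * (t' - t))) by lra.
      assert (0 <= (p - 1) * (t' - t)) by (apply Rmult_le_pos; lra).
      nra. }
  assert (HAp : 0 < A * (p - 1)) by (apply Rmult_lt_0_compat; lra).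
  split.
  - apply Rnot_lt_le; intros Hlt.
    set (G := Rpower (u t) (1 - p)) in *.
    assert (HG : 0 < G) by apply Rpower_pos.
    (* By the slope bound, [u^(1-p)] would reach zero before this time, which is still less than
       [T]. *)
    set (t' := (T + (t + G / (A * (p - 1)))) / 2).
    assert (HGT : G / (A * (p - 1)) < T - t).
    { apply Rmult_lt_reg_r with (A * (p - 1)); [lra|].
      unfold Rdiv; rewrite Rmult_assoc, Rinv_l by lra; lra. }
    assert (HG0 : 0 < G / (A * (p - 1))) by (apply Rdiv_lt_0_compat; lra).
    destruct (Hinc t' ltac:(unfold t'; lra)) as [H1 _].
    assert (H2 : G / (A * (p - 1)) < t' - t) by (unfold t'; lra).
    apply Rmult_lt_compat_l with (r := A * (p - 1)) in H2; [|lra].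
    replace (A * (p - 1) * (G / (A * (p - 1)))) with G in H2 by (field; lra).
    pose proof (Rpower_pos (u t') (1 - p)); lra.
  - apply Rnot_lt_le; intros Hlt.
    (* The excess over the claimed bound. Once [u] exceeds [e^(1/(1-p))], the value [u^(1-p)] is at
       most [e], too small after a decrease limited by the slope. *)
    set (e := Rpower (u t) (1 - p) - B * (p - 1) * (T - t)).
    assert (He : 0 < e) by (unfold e; lra).
    destruct (Hinf (Rpower e (/ (1 - p))) t Ht) as [t' [Ht' HM]].
    destruct (Hinc t' Ht') as [H1 H2].
    assert (Hsmall : Rpower (u t') (1 - p) <= e).
    { replace e with (Rpower (Rpower e (/ (1 - p))) (1 - p)).
      - apply Rpower_le_neg; [lra|]; split; [apply Rpower_pos|lra].
      - rewrite Rpower_mult, Rinv_l, Rpower_1; auto; lra. }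
    assert (HB : 0 < B * (p - 1)).
    { assert (A * (p - 1) * (t' - t) <= B * (p - 1) * (t' - t)) by lra.
      apply Rlt_le_trans with (1 := HAp), Rmult_le_reg_r with (t' - t); lra. }
    assert (B * (p - 1) * (t' - t) < B * (p - 1) * (T - t)) by (apply Rmult_lt_compat_l; lra).
    unfold e in *; lra.
Qed.

(** The exponents satisfy [(1 - p) (- q) = 1] and [(1 - p) (- q - 1) = p]; being negative, [- q] and
    [- q - 1] exchange the roles of [A] and [B]. *)
Lemma power_from_rate p A B q u r : 1 < p -> 0 < A -> 0 < B -> 0 < u -> 0 < r -> q = 1 / (p - 1) ->
  A * (p - 1) * r <= Rpower u (1 - p) <= B * (p - 1) * r ->
  Rpower (B * (p - 1)) (- q) * Rpower r (- q) <= u <= Rpower (A * (p - 1)) (- q) * Rpower r (- q) /\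
  Rpower (B * (p - 1)) (- q - 1) * Rpower r (- q - 1) <= Rpower u p
    <= Rpower (A * (p - 1)) (- q - 1) * Rpower r (- q - 1).
Proof.
  intros Hp HA HB Hu Hr Hq H.
  assert (Hq0 : 0 < q) by (rewrite Hq; apply Rdiv_lt_0_compat; lra).
  assert (HA1 : 0 < A * (p - 1)) by (apply Rmult_lt_0_compat; lra).
  assert (HB1 : 0 < B * (p - 1)) by (apply Rmult_lt_0_compat; lra).
  assert (HAr : 0 < A * (p - 1) * r) by (apply Rmult_lt_0_compat; lra).
  rewrite !Rpower_mult_distr by assumption.
  assert (E1 : u = Rpower (Rpower u (1 - p)) (- q)).
  { rewrite Rpower_mult; replace ((1 - p) * - q) with 1 by (rewrite Hq; field; lra).
    now rewrite Rpower_1. }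
  assert (E2 : Rpower u p = Rpower (Rpower u (1 - p)) (- q - 1)).
  { rewrite Rpower_mult; f_equal; rewrite Hq; field; lra. }
  pose proof (Rpower_pos u (1 - p)).
  split.
  - set (w := Rpower u (1 - p)) in *; rewrite E1; split; apply Rpower_le_neg; lra.
  - rewrite E2; split; apply Rpower_le_neg; lra.
Qed.

(** * Data and lifespan *)

Lemma cont_on_closed_bounded h a b : a <= b -> cont_on_closed h a b ->
  exists K, 0 <= K /\ forall x, a <= x <= b -> Rabs (h x) <= K.
Proof.
  intros Hab Hc.
  assert (C : forall z, continuity_pt (fun x => h (clamp a b x)) z).
  { intros z eps Heps.
    destruct (Hc (clamp a b z) (clamp_in a b z Hab) eps Heps) as [d [Hd Hd']].
    exists d; split; [exact Hd|]; intros y [_ Hy].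
    apply Hd'; [now apply clamp_in|].
    apply Rle_lt_trans with (2 := Hy); now apply clamp_lip. }
  destruct (continuity_ab_maj _ a b Hab (fun z _ => C z)) as [x1 [H1 _]].
  destruct (continuity_ab_min _ a b Hab (fun z _ => C z)) as [x2 [H2 _]].
  exists (Rabs (h (clamp a b x1)) + Rabs (h (clamp a b x2))).
  split; [apply Rplus_le_le_0_compat; apply Rabs_pos|].
  intros x Hx; specialize (H1 x Hx); specialize (H2 x Hx); simpl in H1, H2.
  rewrite (clamp_id a b x Hx) in H1, H2.
  abs_lra.
Qed.

Lemma mean_value_ball h R0 z z' : (forall x, Rabs x < R0 -> ex_derive h x) ->
  Rabs z < R0 -> Rabs z' < R0 -> exists c, Rabs c < R0 /\ Rabs (c - z) <= Rabs (z' - z) /\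
  h z' - h z = Derive h c * (z' - z).
Proof.
  intros Hd Hz Hz'.
  assert (Hin : forall x, Rmin z z' <= x <= Rmax z z' -> Rabs x < R0).
  { intros x Hx; apply Rabs_def1; apply Rabs_def2 in Hz; apply Rabs_def2 in Hz';
      revert Hx; unfold Rmin, Rmax; destruct Rle_dec; lra. }
  destruct (MVT_gen h z z' (Derive h)) as [c [Hc E]].
  - intros x Hx; apply Derive_correct, Hd, Hin; lra.
  - intros x Hx; apply derivable_continuous_pt, ex_derive_Reals_0, Hd, Hin, Hx.
  - exists c; split; [now apply Hin|]; split; [|exact E].
    destruct (Rle_dec z z') as [H|H].
    + rewrite Rmin_left, Rmax_right in Hc by lra; rewrite !Rabs_pos_eq; lra.
    + rewrite Rmin_right, Rmax_left in Hc by lra; rewrite !Rabs_left1; lra.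
Qed.

Lemma C4_closed_ex_derive h R0 x : C4_closed h (- R0) R0 -> Rabs x < R0 -> ex_derive h x.
Proof.
  intros [_ H] Hx; destruct (H 1%nat ltac:(lia)) as [H1 _].
  apply (H1 x); apply Rabs_def2 in Hx; lra.
Qed.

(** Two mean values; the second derivative is bounded up to the ends because its extension [F2] is
    continuous on the closed interval. *)
Lemma C4_closed_taylor h R0 : 0 < R0 -> C4_closed h (- R0) R0 -> taylor_1 0 R0 h.
Proof.
  intros HR H4.
  assert (D1 := fun x => C4_closed_ex_derive h R0 x H4).
  destruct H4 as [_ H]; destruct (H 2%nat ltac:(lia)) as [D2 [F2 [HF2 EF2]]].
  assert (D2' : forall x, Rabs x < R0 -> ex_derive (Derive h) x).
  { intros x Hx; apply (D2 x); apply Rabs_def2 in Hx; lra. }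
  destruct (cont_on_closed_bounded F2 (- R0) R0 ltac:(lra) HF2) as [K [HK HKb]].
  exists (Derive h), K; split; [exact HK|].
  intros z z'; rewrite !Rminus_0_r; intros Hz Hz'.
  destruct (mean_value_ball h R0 z z' D1 Hz Hz') as [c [Hc [Hcz E]]].
  destruct (mean_value_ball (Derive h) R0 z c D2' Hz Hc) as [c2 [Hc2 [_ E2]]].
  assert (HB : Rabs (Derive (Derive h) c2) <= K).
  { apply Rabs_def2 in Hc2.
    change (Derive (Derive h) c2) with (Derive_n h 2 c2); rewrite <- EF2 by lra.
    apply HKb; lra. }
  replace (h z' - h z - Derive h z * (z' - z)) with ((Derive h c - Derive h z) * (z' - z)) by lra.
  rewrite E2, !Rabs_mult, <- (pow2_abs (z' - z)).
  pose proof (Rabs_pos (c - z)); pose proof (Rabs_pos (z' - z)).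
  pose proof (Rabs_pos (Derive (Derive h) c2)).
  replace (K * Rabs (z' - z) ^ 2) with (K * Rabs (z' - z) * Rabs (z' - z)) by ring.
  apply Rmult_le_compat_r; [lra|]; apply Rmult_le_compat; lra.
Qed.

Lemma taylor_1_sub X T X' T' h : Rabs (X' - X) + T' <= T -> taylor_1 X T h -> taylor_1 X' T' h.
Proof.
  intros HS [hd [K [HK H]]]; exists hd, K; split; [exact HK|].
  intros z z' Hz Hz'; apply H; abs_lra.
Qed.

Lemma Sup_seq_real_bounded (a : nat -> R) M : (forall n, a n <= M) ->
  let s := Sup_seq (fun n => Finite (a n)) in
  is_finite s /\ (forall n, a n <= real s) /\ (forall c, (forall n, a n <= c) -> real s <= c).
Proof.
  intros HM s.
  assert (Hub : forall n, Rbar_le (a n) s).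
  { intros n; apply Sup_seq_minor_le with n; apply Rle_refl. }
  assert (Hlub : forall c, (forall n, a n <= c) -> Rbar_le s c).
  { intros c Hc; apply Rbar_not_lt_le; intros Hlt.
    apply Sup_seq_minor_lt in Hlt; destruct Hlt as [n Hn]; simpl in Hn; specialize (Hc n); lra. }
  assert (Hfin : is_finite s).
  { pose proof (Hub 0%nat) as H1; pose proof (Hlub M HM) as H2.
    destruct s; simpl in *; [reflexivity|contradiction|contradiction]. }
  split; [exact Hfin|].
  rewrite <- Hfin in Hub, Hlub; split; [exact Hub|exact Hlub].
Qed.

(** Stated pointwise: the integrands agree only value by value. *)
Lemma iterates_picard p mu g1 g2 f g n x t :
  fst (iterates p mu g1 g2 f g n) x t = fst (picard (source p mu) f g g1 g2 n) x t /\
  snd (iterates p mu g1 g2 f g n) x t = snd (picard (source p mu) f g g1 g2 n) x t.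
Proof.
  revert x t; induction n as [|n IH]; intros x t; [split; reflexivity|].
  simpl; destruct (iterates p mu g1 g2 f g n) as [a b]; simpl in IH |- *.
  assert (E : forall y s, Nfun p mu a b y s = source p mu (total (picard (source p mu) f g g1 g2 n) y s) s).
  { intros y s; destruct (IH y s) as [E1 E2]; unfold Nfun, source, total; now rewrite E1, E2. }
  unfold step; split; (f_equal; [f_equal; ring|]); apply RInt_ext; intros s _; rewrite E;
    do 2 f_equal; ring.
Qed.

(** * The spatially constant subsolution and its blow-up time *)

Section Lifespan.
Context (p mu gam : R) (Hp : 1 < p) (Hmu : 0 < mu) (Hgam : 0 < gam)
  (Hdom : mu <= Rpower 2 (- p) * Rpower gam (p - 1)).

Let q := 1 / (p - 1).
Let a := Rpower 2 (1 - p) / mu.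
Let b := Rpower gam (1 - p).
Let T1 := 1 / ((p - 1) * mu) * ln (a / (a - b)).

(* [v = W ^ (-q)] solves [v' = 2^(1-p) v^p - mu v], [v 0 = gam], and blows up at [T1]. *)
Let W s := a - (a - b) * exp ((p - 1) * mu * s).
Let v s := Rpower (W s) (- q).

(** Makes the logarithm in [T1] meaningful: [b < a] says [mu gam^(1-p) < 2^(1-p)], which [Hdom]
    gives with a factor 2 to spare. *)
Lemma ode_gap_pos : 0 < b < a.
Proof.
  split; [apply Rpower_pos|].
  assert (E2 : Rpower 2 (1 - p) = 2 * Rpower 2 (- p)).
  { replace (1 - p) with (1 + - p) by ring; rewrite Rpower_plus, Rpower_1; lra. }
  assert (Eb : b * Rpower gam (p - 1) = 1).
  { unfold b; rewrite <- Rpower_plus; replace (1 - p + (p - 1)) with 0 by ring; now apply Rpower_O. }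
  assert (Hb : 0 < b) by apply Rpower_pos.
  pose proof (Rpower_pos 2 (- p)).
  unfold a; rewrite E2; apply Rmult_lt_reg_r with mu; [exact Hmu|].
  unfold Rdiv; rewrite Rmult_assoc, Rinv_l, Rmult_1_r by lra.
  apply Rmult_le_compat_l with (r := b) in Hdom; [|lra].
  replace (b * (Rpower 2 (- p) * Rpower gam (p - 1)))
    with (Rpower 2 (- p) * (b * Rpower gam (p - 1))) in Hdom by ring.
  rewrite Eb in Hdom; lra.
Qed.

Let c := (p - 1) * mu.

Lemma ode_rate_pos : 0 < c.
Proof. unfold c; apply Rmult_lt_0_compat; lra. Qed.

Lemma exp_lifespan : exp (c * T1) = a / (a - b).
Proof.
  pose proof ode_gap_pos; pose proof ode_rate_pos as Hc.
  unfold T1; fold c; replace (c * (1 / c * ln (a / (a - b)))) with (ln (a / (a - b))) by (field; lra).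
  apply exp_ln, Rdiv_lt_0_compat; lra.
Qed.

Lemma W_pos s : s < T1 -> 0 < W s.
Proof.
  intros Hs; pose proof ode_gap_pos; pose proof ode_rate_pos.
  assert (exp (c * s) < a / (a - b)) by (rewrite <- exp_lifespan; apply exp_increasing; nra).
  unfold W; fold c.
  assert ((a - b) * exp (c * s) < (a - b) * (a / (a - b))) by (apply Rmult_lt_compat_l; lra).
  replace ((a - b) * (a / (a - b))) with a in * by (field; lra); lra.
Qed.

Lemma v_mono s s' : s <= s' -> s' < T1 -> v s <= v s'.
Proof.
  intros Hs Hs'; pose proof ode_gap_pos; pose proof ode_rate_pos.
  assert (exp (c * s) <= exp (c * s')).
  { destruct (Req_dec s s') as [->|]; [lra|]; apply Rlt_le, exp_increasing; nra. }
  apply Rpower_le_neg.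
  - unfold q; assert (0 < 1 / (p - 1)) by (apply Rdiv_lt_0_compat; lra); lra.
  - split; [now apply W_pos|]; unfold W; fold c; nra.
Qed.

Lemma v_0 : v 0 = gam.
Proof.
  unfold v, W; rewrite Rmult_0_r, exp_0.
  replace (a - (a - b) * 1) with b by ring; unfold b; rewrite Rpower_mult.
  replace ((1 - p) * - q) with 1 by (unfold q; field; lra).
  now apply Rpower_1.
Qed.

(** Bernoulli substitution: [W = v^(1-p)] satisfies the linear equation [W' = - c (a - W)], and
    [q c = mu]. *)
Lemma v_ode s : s < T1 -> is_derive v s (2 * Rpower 2 (- p) * Rpower (v s) p - mu * v s).
Proof.
  intros Hs; assert (HW := W_pos s Hs).
  assert (E2 : 2 * Rpower 2 (- p) = mu * a).
  { unfold a; replace (1 - p) with (1 + - p) by ring; rewrite Rpower_plus, Rpower_1 by lra.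
    field; lra. }
  assert (DW : is_derive W s (- c * (a - W s))).
  { unfold W; fold c; auto_derive; [exact I|ring]. }
  replace (2 * Rpower 2 (- p) * Rpower (v s) p - mu * v s)
    with (- q * Rpower (W s) (- q - 1) * (- c * (a - W s))).
  - now apply is_derive_Rpower_comp.
  - assert (E3 : Rpower (v s) p = Rpower (W s) (- q - 1)).
    { unfold v; rewrite Rpower_mult; f_equal; unfold q; field; lra. }
    assert (E4 : v s = Rpower (W s) (- q - 1) * W s).
    { unfold v; rewrite <- (Rpower_1 (W s)) at 3 by exact HW.
      rewrite <- Rpower_plus; f_equal; ring. }
    assert (E5 : q * c = mu) by (unfold q, c; field; lra).
    rewrite E2, E3, E4.
    replace (- q * Rpower (W s) (- q - 1) * (- c * (a - W s)))
      with (q * c * (Rpower (W s) (- q - 1) * (a - W s))) by ring.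
    rewrite E5; ring.
Qed.

Lemma continuous_of_derivable (h : R -> R) x : ex_derive h x -> continuous h x.
Proof. exact (@ex_derive_continuous R_AbsRing R_NormedModule h x). Qed.

Lemma v_source_ex_RInt t : 0 <= t -> t < T1 -> ex_RInt (fun s => source p mu (v s) s) 0 t.
Proof.
  intros Ht HtT.
  apply ex_RInt_ext with (fun s => Rpower 2 (- p) * exp (p * ln (v s)) - mu / (1 + s) * (v s / 2)).
  - intros s _; unfold source; rewrite powabs_pos by apply Rpower_pos; reflexivity.
  - apply (@ex_RInt_continuous R_CompleteNormedModule); rewrite Rmin_left, Rmax_right by lra.
    intros z Hz; apply continuous_of_derivable.
    assert (Dv : ex_derive v z) by (eexists; apply v_ode; lra).
    assert (Pv : 0 < v z) by apply Rpower_pos.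
    clearbody v; auto_derive; repeat split; auto; lra.
Qed.

(** The equation for [v] carries the full damping [mu v], at least [mu v / (1 + s)], so
    [v' <= 2 source]. *)
Lemma v_le_integral t : 0 <= t -> t < T1 ->
  v t <= gam + 2 * RInt (fun s => source p mu (v s) s) 0 t.
Proof.
  intros Ht HtT.
  set (dv := fun s => 2 * Rpower 2 (- p) * Rpower (v s) p - mu * v s).
  assert (I : is_RInt dv 0 t (v t - v 0)).
  { apply (@is_RInt_derive R_CompleteNormedModule v dv); rewrite Rmin_left, Rmax_right by lra;
      intros z Hz.
    - apply v_ode; lra.
    - apply continuous_of_derivable; unfold dv, Rpower at 2.
      assert (Dv : ex_derive v z) by (eexists; apply v_ode; lra).
      assert (Pv : 0 < v z) by apply Rpower_pos.
      clearbody v; auto_derive; repeat split; auto; lra. }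
  rewrite v_0 in I.
  assert (E : RInt dv 0 t = v t - gam) by (apply is_RInt_unique; exact I).
  assert (Hex := v_source_ex_RInt t Ht HtT).
  rewrite <- RInt_mult_l by exact Hex.
  cut (RInt dv 0 t <= RInt (fun s => 2 * source p mu (v s) s) 0 t); [lra|].
  apply RInt_le; [exact Ht|eexists; exact I|now apply ex_RInt_mult_l|].
  intros s Hs; unfold dv, source.
  assert (Pv : 0 < v s) by apply Rpower_pos.
  rewrite powabs_pos by exact Pv.
  pose proof (damping_coef_le mu Hmu s ltac:(lra)).
  nra.
Qed.

(** A cone of bounded iterates higher than [T1] would keep [v] below [M] on all of [[0, T1)]. *)
Lemma lifespan_bound f g g1 g2 lam m X T M : g1 + g2 = gam -> 1 < lam -> 0 <= m ->
  (1 + lam) * m <= source p mu gam 0 -> cauchy_data f g g1 g2 m X T ->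
  (forall n x t, cone X T x t -> total (picard (source p mu) f g g1 g2 n) x t <= M) ->
  T <= T1.
Proof.
  intros Hgg Hlam Hm HmF HD HM; apply Rnot_lt_le; intros HT.
  pose proof ode_gap_pos as Hab; pose proof ode_rate_pos as Hc.
  assert (HF : increasing_nonlinearity (source p mu) (g1 + g2))
    by (rewrite Hgg; now apply source_increasing_nonlinearity).
  assert (HT1 : 0 < T1).
  { assert (1 < exp (c * T1)).
    { rewrite exp_lifespan; apply Rmult_lt_reg_r with (a - b); [lra|].
      unfold Rdiv; rewrite Rmult_assoc, Rinv_l by lra; lra. }
    apply Rnot_le_lt; intros Hle.
    assert (exp (c * T1) <= 1); [|lra].
    rewrite <- exp_0; destruct (Req_dec (c * T1) 0) as [->|]; [lra|].
    apply Rlt_le, exp_increasing; nra. }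
  assert (Hv : forall s, 0 <= s < T1 -> v s <= M).
  { intros s Hs; set (S := (s + T1) / 2).
    assert (HS : s < S < T1) by (unfold S; lra).
    apply (ode_subsolution_le (source p mu) f g g1 g2 lam m HF Hlam Hm) with X S; try lra.
    - now rewrite Hgg.
    - apply cauchy_data_sub with X T; auto; rewrite Rminus_diag, Rabs_R0; lra.
    - intros n x t Hc'; apply HM; apply cone_le with S; auto; lra.
    - intros r r' Hr Hr'; apply v_mono; lra.
    - rewrite Hgg; apply v_0.
    - intros t Ht; apply v_source_ex_RInt; lra.
    - intros t Ht; rewrite Hgg; apply v_le_integral; lra. }
  (* A value that [W] takes in [(0, T1)], at the time [s] below, and small enough that
     [v s = w^(-q)] exceeds [M]. *)
  set (w := Rmin (Rpower M (1 - p)) b / 2).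
  assert (Hw0 : 0 < Rmin (Rpower M (1 - p)) b) by (apply Rmin_pos; [apply Rpower_pos|lra]).
  assert (Hw1 : w < Rpower M (1 - p)).
  { pose proof (Rmin_l (Rpower M (1 - p)) b); unfold w; lra. }
  assert (Hw2 : 0 < w < b).
  { pose proof (Rmin_r (Rpower M (1 - p)) b); unfold w; lra. }
  clearbody w.
  set (s := ln ((a - w) / (a - b)) / c).
  assert (Hpos : 0 < (a - w) / (a - b)) by (apply Rdiv_lt_0_compat; lra).
  assert (Es : exp (c * s) = (a - w) / (a - b)).
  { unfold s; replace (c * (ln ((a - w) / (a - b)) / c)) with (ln ((a - w) / (a - b))) by (field; lra).
    now apply exp_ln. }
  assert (Hs1 : 0 < s).
  { apply Rmult_lt_reg_l with c; [exact Hc|]; rewrite Rmult_0_r; apply exp_lt_inv.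
    rewrite Es, exp_0; apply Rmult_lt_reg_r with (a - b); [lra|].
    unfold Rdiv; rewrite Rmult_assoc, Rinv_l by lra; lra. }
  assert (Hs2 : s < T1).
  { apply Rmult_lt_reg_l with c; [exact Hc|]; apply exp_lt_inv.
    rewrite Es, exp_lifespan; unfold Rdiv; apply Rmult_lt_compat_r; [apply Rinv_0_lt_compat|]; lra. }
  assert (EW : W s = w) by (unfold W; fold c; rewrite Es; field; lra).
  specialize (Hv s ltac:(lra)).
  assert (Ev : Rpower (v s) (1 - p) = w).
  { unfold v; rewrite EW, Rpower_mult; replace (- q * (1 - p)) with 1 by (unfold q; field; lra).
    apply Rpower_1; lra. }
  assert (Rpower M (1 - p) <= Rpower (v s) (1 - p)); [|lra].
  apply Rpower_le_neg; [lra|]; split; [apply Rpower_pos|exact Hv].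
Qed.

End Lifespan.

(** * The blow-up time *)

Section Blowup.
Context (p mu lam m Rs Ts g1 g2 : R) (f g : R -> R) (Hp : 1 < p) (Hmu : 0 < mu)
  (Hg1 : 0 < g1) (Hg2 : 0 < g2)
  (Hdom : mu <= Rpower 2 (- p) * Rpower (g1 + g2) (p - 1))
  (Hlam : 1 < lam) (Hm : 0 <= m) (HmF : (1 + lam) * m <= source p mu (g1 + g2) 0)
  (HD : cauchy_data f g g1 g2 m 0 (Rs + Ts))
  (Tf : taylor_1 0 (Rs + Ts) f) (Tg : taylor_1 0 (Rs + Ts) g)
  (HT1 : 1 / ((p - 1) * mu) * ln ((Rpower 2 (1 - p) / mu) /
           (Rpower 2 (1 - p) / mu - Rpower (g1 + g2) (1 - p))) < Ts).

Let F := source p mu.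
Let u n := total (picard F f g g1 g2 n).
Let PhiR x t := real (Phi p mu g1 g2 f g x t).
Let PsiR x t := real (Psi p mu g1 g2 f g x t).
Let U := total (PhiR, PsiR).

Lemma source_nonlinearity : increasing_nonlinearity F (g1 + g2).
Proof. apply source_increasing_nonlinearity; auto; lra. Qed.

Let HF := source_nonlinearity.

Lemma picard_sup_bounded x t M : cone 0 (Rs + Ts) x t -> (forall n, u n x t <= M) ->
  is_finite (Phi p mu g1 g2 f g x t) /\ is_finite (Psi p mu g1 g2 f g x t) /\
  (forall n, fst (picard F f g g1 g2 n) x t <= PhiR x t) /\
  (forall n, snd (picard F f g g1 g2 n) x t <= PsiR x t) /\
  (forall c, (forall n, fst (picard F f g g1 g2 n) x t <= c) -> PhiR x t <= c) /\
  (forall c, (forall n, snd (picard F f g g1 g2 n) x t <= c) -> PsiR x t <= c).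
Proof.
  intros Hc HM.
  assert (I : forall n, g1 <= fst (picard F f g g1 g2 n) x t /\ g2 <= snd (picard F f g g1 g2 n) x t).
  { intros n; destruct (picard_invariant F f g g1 g2 lam m HF Hlam Hm HmF 0 (Rs + Ts) HD n)
      as [I1 [I2 _]]; split; auto. }
  assert (E := fun n => iterates_picard p mu g1 g2 f g n x t); fold F in E.
  destruct (Sup_seq_real_bounded (fun n => fst (iterates p mu g1 g2 f g n) x t) M) as [A1 [A2 A3]].
  { intros n; rewrite (proj1 (E n)); specialize (HM n); destruct (I n); unfold u, total in HM; lra. }
  destruct (Sup_seq_real_bounded (fun n => snd (iterates p mu g1 g2 f g n) x t) M) as [B1 [B2 B3]].
  { intros n; rewrite (proj2 (E n)); specialize (HM n); destruct (I n); unfold u, total in HM; lra. }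
  repeat split; auto.
  - intros n; rewrite <- (proj1 (E n)); apply A2.
  - intros n; rewrite <- (proj2 (E n)); apply B2.
  - intros c Hc'; apply A3; intros n; rewrite (proj1 (E n)); apply Hc'.
  - intros c Hc'; apply B3; intros n; rewrite (proj2 (E n)); apply Hc'.
Qed.

(** Translates the finiteness in the definition of the blow-up time into a bound on the iterates at
    one point. *)
Lemma sum_finite_iff x t : cone 0 (Rs + Ts) x t ->
  is_finite (Rbar_plus (Phi p mu g1 g2 f g x t) (Psi p mu g1 g2 f g x t)) <->
  exists M, forall n, u n x t <= M.
Proof.
  intros Hc; split.
  - assert (E := fun n => iterates_picard p mu g1 g2 f g n x t); fold F in E.
    assert (H1 : forall n, Rbar_le (fst (picard F f g g1 g2 n) x t) (Phi p mu g1 g2 f g x t)).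
    { intros n; rewrite <- (proj1 (E n)); apply Sup_seq_minor_le with n; apply Rle_refl. }
    assert (H2 : forall n, Rbar_le (snd (picard F f g g1 g2 n) x t) (Psi p mu g1 g2 f g x t)).
    { intros n; rewrite <- (proj2 (E n)); apply Sup_seq_minor_le with n; apply Rle_refl. }
    (* The first terms exclude minus infinity, hence also the sum of opposite infinities, to which
       [Rbar_plus] assigns the finite value 0. *)
    pose proof (H1 0%nat) as H10; pose proof (H2 0%nat) as H20.
    destruct (Phi p mu g1 g2 f g x t) as [a| |], (Psi p mu g1 g2 f g x t) as [b| |];
      simpl in H10, H20; try contradiction; intros Hfin; try discriminate Hfin.
    exists (a + b); intros n; apply Rplus_le_compat; [apply (H1 n)|apply (H2 n)].
  - intros [M HM]; destruct (picard_sup_bounded x t M Hc HM) as [A [B _]].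
    rewrite <- A, <- B; reflexivity.
Qed.

Lemma picard_bounded_cone x t M : cone 0 (Rs + Ts) x t -> (forall n, u n x t <= M) ->
  forall n y s, cone x t y s -> u n y s <= M.
Proof.
  intros Hc HM n y s Hy; apply Rle_trans with (2 := HM n).
  apply (cone_bound (g1 + g2) lam Hlam 0 (Rs + Ts) (u n) x t); auto.
  now apply picard_admissible with m.
Qed.

(** A bound at the later time [t'] controls the cone with apex [(x, t')], which contains [(x, t)]
    and on which the limit has been analysed. *)
Lemma derivative_bounds_below x t t' M : cone 0 (Rs + Ts) x t' -> (forall n, u n x t' <= M) ->
  0 < t < t' ->
  is_finite (Phi p mu g1 g2 f g x t) /\ is_finite (Psi p mu g1 g2 f g x t) /\
  ex_derive (PhiR x) t /\ ex_derive (PsiR x) t /\ g1 + g2 <= U x t /\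
  (forall n, u n x t <= U x t) /\
  let lo := lam / (1 + lam) * (/ 2 * Rpower 2 (- p)) * Rpower (U x t) p in
  let hi := lam / (lam - 1) * Rpower 2 (- p) * Rpower (U x t) p in
  lo <= Derive (PhiR x) t <= hi /\ lo <= Derive (PsiR x) t <= hi.
Proof.
  intros Hc HM Ht.
  assert (HMc := picard_bounded_cone x t' M Hc HM).
  assert (HS : Rabs (x - 0) + t' <= Rs + Ts) by (destruct Hc; lra).
  assert (Hsub : forall y s, cone x t' y s -> cone 0 (Rs + Ts) y s)
    by (intros y s; now apply cone_sub).
  assert (Hsup := fun y s Hy => picard_sup_bounded y s M (Hsub y s Hy) (fun n => HMc n y s Hy)).
  assert (Ct : cone x t' x t) by (split; [lra|rewrite Rminus_diag, Rabs_R0; lra]).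
  assert (HD' := cauchy_data_sub _ _ _ _ _ _ _ _ _ HS HD).
  assert (P1 : forall n y s, cone x t' y s -> fst (picard F f g g1 g2 n) y s <= PhiR y s)
    by (intros n y s Hy; apply (Hsup y s Hy)).
  assert (P2 : forall n y s, cone x t' y s -> snd (picard F f g g1 g2 n) y s <= PsiR y s)
    by (intros n y s Hy; apply (Hsup y s Hy)).
  assert (P3 : forall y s c, cone x t' y s ->
    (forall n, fst (picard F f g g1 g2 n) y s <= c) -> PhiR y s <= c)
    by (intros y s c Hy; apply (Hsup y s Hy)).
  assert (P4 : forall y s c, cone x t' y s ->
    (forall n, snd (picard F f g g1 g2 n) y s <= c) -> PsiR y s <= c)
    by (intros y s c Hy; apply (Hsup y s Hy)).
  assert (Hge : g1 + g2 <= U x t) by (exact (limit_sum_ge F f g g1 g2 x t' PhiR PsiR P1 P2 x t Ct)).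
  destruct (limit_derive_bounds F f g g1 g2 lam m HF Hlam Hm HmF x t' M HD' HMc PhiR PsiR
    P1 P2 P3 P4 x t (taylor_1_sub _ _ _ _ _ HS Tf) (taylor_1_sub _ _ _ _ _ HS Tg) Ct ltac:(lra))
    as [D1 [D2 [D3 D4]]].
  fold U in D3, D4.
  destruct (Hsup x t Ct) as [S1 [S2 _]].
  pose proof (source_lower p mu (g1 + g2) Hp Hmu ltac:(lra) Hdom (U x t) t Hge ltac:(lra)) as L1.
  pose proof (source_upper p mu (g1 + g2) Hmu ltac:(lra) (U x t) t Hge ltac:(lra)) as L2.
  fold F in L1, L2.
  assert (K1 : 0 < lam / (1 + lam)) by (apply Rdiv_lt_0_compat; lra).
  assert (K2 : 0 < lam / (lam - 1)) by (apply Rdiv_lt_0_compat; lra).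
  apply Rmult_le_compat_l with (r := lam / (1 + lam)) in L1; [|lra].
  apply Rmult_le_compat_l with (r := lam / (lam - 1)) in L2; [|lra].
  repeat split; auto; try lra.
  intros n; apply Rplus_le_compat; [now apply P1|now apply P2].
Qed.

Lemma bounded_lifespan x t M : cone 0 (Rs + Ts) x t -> (forall n, u n x t <= M) ->
  t <= 1 / ((p - 1) * mu) * ln ((Rpower 2 (1 - p) / mu) /
         (Rpower 2 (1 - p) / mu - Rpower (g1 + g2) (1 - p))).
Proof.
  intros Hc HM.
  assert (HS : Rabs (x - 0) + t <= Rs + Ts) by (destruct Hc; lra).
  apply (lifespan_bound p mu (g1 + g2) Hp Hmu ltac:(lra) Hdom f g g1 g2 lam m x t M); auto.
  - now apply cauchy_data_sub with 0 (Rs + Ts).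
  - now apply picard_bounded_cone.
Qed.

Section Vertical.
Context (x t0 : R) (Hin : in_Omega p mu g1 g2 f g Rs Ts x t0).

Let Tb := Tblow p mu g1 g2 f g Ts x.
Let T := real Tb.

Lemma vertical_cone t : 0 <= t < Ts -> cone 0 (Rs + Ts) x t.
Proof. intros Ht; destruct Hin as [Hx _]; split; [lra|rewrite Rminus_0_r; lra]. Qed.

(** The strict inequality [T < Ts] leaves room above [(x, T)] for the continuation argument; the
    last clause supplies the bounded later times needed for derivative bounds below [T]. *)
Lemma blowup_time_spec : is_finite Tb /\ t0 < T /\ T < Ts /\
  (forall t, 0 < t < Ts -> (exists M, forall n, u n x t <= M) -> t <= T) /\
  (forall t, t < T -> exists t', t < t' <= T /\ 0 < t' /\ exists M, forall n, u n x t' <= M).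
Proof.
  destruct Hin as [Hx [Ht0 Hlt]]; fold Tb in Hlt.
  set (E := fun t => 0 < t < Ts /\
    is_finite (Rbar_plus (Phi p mu g1 g2 f g x t) (Psi p mu g1 g2 f g x t))).
  assert (HE : forall t, 0 < t < Ts -> (E t <-> exists M, forall n, u n x t <= M)).
  { intros t Ht; rewrite <- sum_finite_iff by (apply vertical_cone; lra).
    unfold E; tauto. }
  destruct (Lub_Rbar_correct E) as [L1 L2]; change (Lub_Rbar E) with Tb in L1, L2.
  set (T1 := 1 / ((p - 1) * mu) * ln ((Rpower 2 (1 - p) / mu) /
         (Rpower 2 (1 - p) / mu - Rpower (g1 + g2) (1 - p)))) in *.
  assert (HTb : Rbar_le Tb T1).
  { apply L2; intros t HEt; assert (Ht : 0 < t < Ts) by apply HEt.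
    destruct (proj1 (HE t Ht) HEt) as [M HM].
    apply (bounded_lifespan x t M); [apply vertical_cone; lra|exact HM]. }
  assert (Hfin : is_finite Tb).
  { destruct Tb; simpl in *; [reflexivity|contradiction|contradiction]. }
  assert (ETb : Tb = Finite T) by (symmetry; exact Hfin).
  rewrite ETb in L1, L2, Hlt, HTb; simpl in Hlt, HTb.
  split; [exact Hfin|]; split; [exact Hlt|]; split; [unfold T1 in *; lra|]; split.
  - intros t Ht HMt; apply (L1 t), HE; auto.
  - intros t Ht; apply Classical_Prop.NNPP; intros Hno.
    assert (Hle : Rbar_le T t); [|simpl in Hle; lra].
    apply L2; intros s HEs; apply Rnot_lt_le; intros Hts; apply Hno.
    assert (Hs : 0 < s < Ts) by apply HEs.
    exists s; repeat split; try lra; [exact (L1 s HEs)|].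
    now apply HE.
Qed.

Lemma blowup_unbounded M t : 0 < t < T -> exists t', t < t' < T /\ M < U x t'.
Proof.
  intros Ht; destruct blowup_time_spec as [_ [_ [HTs [Hmax Hlt]]]].
  apply Classical_Prop.NNPP; intros Hno.
  assert (HU : forall t', t < t' < T -> U x t' <= M).
  { intros t' Ht'; apply Rnot_lt_le; intros H; apply Hno; now exists t'. }
  assert (Hu : forall n t', 0 <= t' < T -> u n x t' <= M).
  { intros n t' Ht'.
    (* A time in [(t, T)] after [t']: by monotonicity in time the bound on [(t, T)] extends down to
       time 0. *)
    set (s := (Rmax t t' + T) / 2).
    assert (Hmx : Rmax t t' < T) by (apply Rmax_lub_lt; lra).
    pose proof (Rmax_l t t'); pose proof (Rmax_r t t').
    apply Rle_trans with (u n x s).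
    - apply (adm_mono _ _ _ _ _
        (picard_admissible F f g g1 g2 lam m HF Hlam Hm HmF 0 (Rs + Ts) HD n)).
      + apply vertical_cone; lra.
      + apply vertical_cone; unfold s; lra.
      + rewrite Rminus_diag, Rabs_R0; apply Rmult_le_pos; unfold s; lra.
    - apply Rle_trans with (2 := HU s ltac:(unfold s; lra)).
      destruct (Hlt s ltac:(unfold s; lra)) as [s' [Hs' [_ [M' HM']]]].
      apply (derivative_bounds_below x s s' M'); auto; [apply vertical_cone|]; unfold s in *; lra. }
  destruct (picard_bounded_beyond F f g g1 g2 lam m HF Hlam Hm HmF 0 (Rs + Ts) x T M (Ts - T))
    as [d [Hd HMd]]; auto; try lra.
  { destruct Hin as [Hx _]; rewrite Rminus_0_r; lra. }
  assert (T + d <= T); [|lra].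
  apply Hmax; [lra|]; now exists (3 * M).
Qed.

(** The factors 2 come from adding the bounds for the two components. *)
Lemma blowup_rates :
  let A := 2 * (lam / (1 + lam) * (/ 2 * Rpower 2 (- p))) in
  let B := 2 * (lam / (lam - 1) * Rpower 2 (- p)) in
  A * (p - 1) * (T - t0) <= Rpower (U x t0) (1 - p) <= B * (p - 1) * (T - t0).
Proof.
  intros A B.
  destruct blowup_time_spec as [_ [Ht0 [HTs [_ Hlt]]]].
  destruct Hin as [_ [Ht00 _]].
  apply (blowup_rate p A B T (U x) (fun s => Derive (PhiR x) s + Derive (PsiR x) s)); auto; try lra.
  - pose proof (Rpower_pos 2 (- p)).
    assert (0 < lam / (1 + lam)) by (apply Rdiv_lt_0_compat; lra).
    unfold A; apply Rmult_lt_0_compat; [lra|]; apply Rmult_lt_0_compat; lra.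
  - intros s Hs; destruct (Hlt s ltac:(lra)) as [s' [Hs' [_ [M' HM']]]].
    destruct (derivative_bounds_below x s s' M') as [_ [_ [D1 [D2 [Hge [_ [D3 D4]]]]]]]; auto.
    + apply vertical_cone; lra.
    + lra.
    + split; [lra|]; split; [|unfold A, B; lra].
      apply (@is_derive_plus R_AbsRing R_NormedModule (PhiR x) (PsiR x));
        now apply Derive_correct.
  - exact blowup_unbounded.
Qed.

End Vertical.
End Blowup.

(** * From (A1)-(A4) to the estimates, with explicit constants *)

Theorem theorem3p2 :
  forall p eps0 : R, 1 < p -> 0 < eps0 ->
  exists C1 C2 : R, 0 < C1 /\ 0 < C2 /\
  forall (mu Rs Ts g1 g2 : R) (f g : R -> R),
    0 < mu -> p < 1 + 2 / mu -> 0 < Rs -> 0 < Ts ->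
    0 < g1 -> 0 < g2 ->
    g1 + g2 > Rmax 1 (Rpower (mu * p * Rpower 2 p) (1 / (p - 1))) ->
    (* (A1) *)
    1 / ((p - 1) * mu) *
      ln ((Rpower 2 (1 - p) / mu) /
          (Rpower 2 (1 - p) / mu - Rpower (g1 + g2) (1 - p))) < Ts ->
    (* (A2) *)
    (forall x, Rabs x < Rs + Ts -> g1 <= f x /\ g2 <= g x) ->
    (* (A3) *)
    C4_closed f (- (Rs + Ts)) (Rs + Ts) ->
    C4_closed g (- (Rs + Ts)) (Rs + Ts) ->
    (* (A4) *)
    (forall x, Rabs x < Rs + Ts ->
       (2 + eps0) * (Rabs (Derive f x) + Rabs (Derive g x))
       <= Rpower 2 (- p) * Rpower (g1 + g2) p - mu / 2 * (g1 + g2)) ->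
    let q := 1 / (p - 1) in
    forall x t, in_Omega p mu g1 g2 f g Rs Ts x t ->
    let ph := fun s => real (Phi p mu g1 g2 f g x s) in
    let ps := fun s => real (Psi p mu g1 g2 f g x s) in
    let Tx := real (Tblow p mu g1 g2 f g Ts x) in
    let u := ph t + ps t in
    is_finite (Phi p mu g1 g2 f g x t) /\ is_finite (Psi p mu g1 g2 f g x t) /\
    ex_derive ph t /\ ex_derive ps t /\
    C1 * Rpower u p <= Derive ph t <= C2 * Rpower u p /\
    C1 * Rpower (Tx - t) (- q - 1) <= Derive ph t
      <= C2 * Rpower (Tx - t) (- q - 1) /\
    C1 * Rpower u p <= Derive ps t <= C2 * Rpower u p /\
    C1 * Rpower (Tx - t) (- q - 1) <= Derive ps t
      <= C2 * Rpower (Tx - t) (- q - 1) /\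
    C1 * Rpower (Tx - t) (- q) <= u <= C2 * Rpower (Tx - t) (- q).
Proof.
  intros p eps0 Hp Heps.
  set (lam := 1 + eps0).
  set (lo := lam / (1 + lam) * (/ 2 * Rpower 2 (- p))).
  set (hi := lam / (lam - 1) * Rpower 2 (- p)).
  set (A := 2 * lo); set (B := 2 * hi).
  set (q := 1 / (p - 1)).
  (* The pair [lo], [hi] compares the derivatives with [u^p], [c1], [d1] with [(T(x) - t)^(-q-1)],
     and [c2], [d2] compare [u] with [(T(x) - t)^(-q)]. All depend on [p] and [eps0] only. *)
  set (c1 := lo * Rpower (B * (p - 1)) (- q - 1)); set (c2 := Rpower (B * (p - 1)) (- q)).
  set (d1 := hi * Rpower (A * (p - 1)) (- q - 1)); set (d2 := Rpower (A * (p - 1)) (- q)).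
  assert (Hlam : 1 < lam) by (unfold lam; lra).
  pose proof (Rpower_pos 2 (- p)) as H2p.
  assert (Hlo : 0 < lo).
  { unfold lo; apply Rmult_lt_0_compat; [apply Rdiv_lt_0_compat; lra|lra]. }
  assert (Hhi : 0 < hi).
  { unfold hi; apply Rmult_lt_0_compat; [apply Rdiv_lt_0_compat; lra|lra]. }
  assert (Hc1 : 0 < c1) by (apply Rmult_lt_0_compat; [exact Hlo|apply Rpower_pos]).
  assert (Hc2 : 0 < c2) by apply Rpower_pos.
  assert (Hd1 : 0 < d1) by (apply Rmult_lt_0_compat; [exact Hhi|apply Rpower_pos]).
  exists (Rmin lo (Rmin c1 c2)), (Rmax hi (Rmax d1 d2)).
  split; [repeat apply Rmin_pos; assumption|].
  split; [apply Rlt_le_trans with (1 := Hhi), Rmax_l|].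
  intros mu Rs Ts g1 g2 f g Hmu _ HRs HTs Hg1 Hg2 Hg HT1 HA2 HCf HCg HA4 q' x t Hin ph ps Tx u.
  change q' with q; clear q'.
  (* The threshold on [g1 + g2], raised to the power [p - 1], gives this with an extra factor
     [p > 1]. *)
  assert (Hdom : mu <= Rpower 2 (- p) * Rpower (g1 + g2) (p - 1)).
  { assert (Hgp := Rle_lt_trans _ _ _ (Rmax_r _ _) Hg).
    pose proof (Rpower_pos 2 p) as H2.
    assert (Hmp : 0 < mu * p * Rpower 2 p) by (repeat apply Rmult_lt_0_compat; lra).
    assert (E : mu * p * Rpower 2 p <= Rpower (g1 + g2) (p - 1)).
    { replace (mu * p * Rpower 2 p)
        with (Rpower (Rpower (mu * p * Rpower 2 p) q) (p - 1)).
      - apply Rle_Rpower_l; [lra|]; split; [apply Rpower_pos|lra].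
      - rewrite Rpower_mult; replace (q * (p - 1)) with 1 by (unfold q; field; lra).
        now apply Rpower_1. }
    apply Rmult_le_compat_l with (r := Rpower 2 (- p)) in E; [|lra].
    assert (E1 : Rpower 2 (- p) * Rpower 2 p = 1).
    { rewrite <- Rpower_plus, Rplus_opp_l; apply Rpower_O; lra. }
    replace (Rpower 2 (- p) * (mu * p * Rpower 2 p))
      with (mu * p * (Rpower 2 (- p) * Rpower 2 p)) in E by ring.
    rewrite E1 in E; nra. }
  set (S0 := source p mu (g1 + g2) 0).
  assert (ES0 : S0 = Rpower 2 (- p) * Rpower (g1 + g2) p - mu / 2 * (g1 + g2)).
  { unfold S0, source; rewrite powabs_pos by lra; field. }
  (* The largest slope that (A4) allows to the data, for which [(1 + lam) m] is exactly the initial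
     growth rate [S0]. *)
  set (m := S0 / (2 + eps0)).
  assert (EmS : (1 + lam) * m = S0) by (unfold m, lam; field; lra).
  assert (HS0 : 0 <= S0).
  { apply (nl_pos (source p mu)), source_increasing_nonlinearity; auto; lra. }
  assert (Hm : 0 <= m).
  { unfold m; apply Rmult_le_pos; [exact HS0|]; apply Rlt_le, Rinv_0_lt_compat; lra. }
  assert (Hder : forall z, Rabs z < Rs + Ts -> Rabs (Derive f z) <= m /\ Rabs (Derive g z) <= m).
  { intros z Hz; specialize (HA4 z Hz); rewrite <- ES0, <- EmS in HA4.
    replace (2 + eps0) with (1 + lam) in HA4 by (unfold lam; ring).
    apply Rmult_le_reg_l in HA4; [|lra].
    pose proof (Rabs_pos (Derive f z)); pose proof (Rabs_pos (Derive g z)); lra. }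
  assert (Hlip : forall h, C4_closed h (- (Rs + Ts)) (Rs + Ts) ->
    (forall z, Rabs z < Rs + Ts -> Rabs (Derive h z) <= m) ->
    forall z z', Rabs (z - 0) < Rs + Ts -> Rabs (z' - 0) < Rs + Ts ->
      Rabs (h z - h z') <= m * Rabs (z - z')).
  { intros h Hh Hb z z'; rewrite !Rminus_0_r; intros Hz Hz'.
    destruct (mean_value_ball h (Rs + Ts) z' z (fun y => C4_closed_ex_derive h _ y Hh) Hz' Hz)
      as [c [Hc [_ E]]].
    rewrite E, Rabs_mult; apply Rmult_le_compat_r; [apply Rabs_pos|now apply Hb]. }
  assert (HD : cauchy_data f g g1 g2 m 0 (Rs + Ts)).
  { split; try (intros z; rewrite Rminus_0_r; intros Hz; now apply HA2);
      apply Hlip; auto; intros z Hz; now apply Hder. }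
  assert (Tf : taylor_1 0 (Rs + Ts) f) by (apply C4_closed_taylor; auto; lra).
  assert (Tg : taylor_1 0 (Rs + Ts) g) by (apply C4_closed_taylor; auto; lra).
  assert (HmF : (1 + lam) * m <= S0) by lra.
  destruct (blowup_time_spec p mu lam m Rs Ts g1 g2 f g Hp Hmu Hg1 Hg2 Hdom Hlam Hm HmF HD HT1 x t Hin)
    as [_ [HtT [HTs' [_ Hlt]]]].
  assert (Hr := blowup_rates p mu lam m Rs Ts g1 g2 f g Hp Hmu Hg1 Hg2 Hdom Hlam Hm HmF HD Tf Tg HT1 x t Hin).
  cbv zeta in Hr; fold lo hi A B in Hr.
  destruct (Hlt t HtT) as [t' [Ht' [Ht'0 [M HM]]]].
  assert (Hx : Rabs x < Rs /\ 0 < t) by (split; apply Hin).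
  destruct (derivative_bounds_below p mu lam m Rs Ts g1 g2 f g Hp Hmu Hg1 Hg2 Hdom Hlam Hm HmF HD Tf Tg
    x t t' M) as [F1 [F2 [D1 [D2 [Hge [_ [D3 D4]]]]]]]; auto.
  { split; [lra|rewrite Rminus_0_r; lra]. }
  { lra. }
  change (total _ x t) with u in Hr, Hge, D3, D4.
  fold lo hi in D3, D4.
  change (real (Tblow p mu g1 g2 f g Ts x)) with Tx in Hr, HtT.
  destruct (power_from_rate p A B q u (Tx - t)) as [R1 R2]; auto; try (unfold A, B; lra).
  fold c2 d2 in R1.
  assert (Pq : 0 < Rpower (Tx - t) (- q)) by apply Rpower_pos.
  assert (Pq1 : 0 < Rpower (Tx - t) (- q - 1)) by apply Rpower_pos.
  assert (Pu : 0 < Rpower u p) by apply Rpower_pos.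
  set (C1 := Rmin lo (Rmin c1 c2)); set (C2 := Rmax hi (Rmax d1 d2)).
  assert (L1 : C1 <= lo) by apply Rmin_l.
  assert (L2 : C1 <= c1) by (eapply Rle_trans; [apply Rmin_r|apply Rmin_l]).
  assert (L3 : C1 <= c2) by (eapply Rle_trans; [apply Rmin_r|apply Rmin_r]).
  assert (L4 : hi <= C2) by apply Rmax_l.
  assert (L5 : d1 <= C2) by (eapply Rle_trans; [apply Rmax_l|apply Rmax_r]).
  assert (L6 : d2 <= C2) by (eapply Rle_trans; [apply Rmax_r|apply Rmax_r]).
  assert (N1 : C1 * Rpower u p <= lo * Rpower u p) by (apply Rmult_le_compat_r; lra).
  assert (N2 : hi * Rpower u p <= C2 * Rpower u p) by (apply Rmult_le_compat_r; lra).
  assert (N3 : C1 * Rpower (Tx - t) (- q - 1) <= lo * Rpower u p).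
  { apply Rle_trans with (c1 * Rpower (Tx - t) (- q - 1)); [apply Rmult_le_compat_r; lra|].
    unfold c1; rewrite Rmult_assoc; apply Rmult_le_compat_l; lra. }
  assert (N4 : hi * Rpower u p <= C2 * Rpower (Tx - t) (- q - 1)).
  { apply Rle_trans with (d1 * Rpower (Tx - t) (- q - 1)); [|apply Rmult_le_compat_r; lra].
    unfold d1; rewrite Rmult_assoc; apply Rmult_le_compat_l; lra. }
  assert (N5 : C1 * Rpower (Tx - t) (- q) <= c2 * Rpower (Tx - t) (- q))
    by (apply Rmult_le_compat_r; lra).
  assert (N6 : d2 * Rpower (Tx - t) (- q) <= C2 * Rpower (Tx - t) (- q))
    by (apply Rmult_le_compat_r; lra).
  change (fun s => real (Phi p mu g1 g2 f g x s)) with ph in D1, D3.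
  change (fun s => real (Psi p mu g1 g2 f g x s)) with ps in D2, D4.
  clearbody C1 C2.
  repeat split; auto; lra.
Qed.
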